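(* Let $X=(X_1,\ldots,X_m)$ be a Gaussian vector with positive definite covariance matrix. Then $X$ is conditionally increasing in sequence (CIS) if and only if $X$ is positively DAG dependent with respect to the full DAG on $[m]=\{1,\ldots,m\}$ whose arrows are $i\to j$ for all $i<j$.
   Context: CIS: a random vector $X=(X_1,\ldots,X_m)$ is conditionally increasing in sequence if for every $i\in[m]$ and every fixed $x_i\in\mathbb{R}$, the function $(x_1,\ldots,x_{i-1})\mapsto \mathbb{P}(X_i\ge x_i\mid X_j=x_j \text{ for all } j<i)$ is non-decreasing with respect to the coordinatewise partial order. For Gaussian vectors with positive definite covariance the conditional law is the usual Gaussian conditional distribution. Positive DAG dependence: let $G$ be a DAG (directed acyclic graph) on $[m]$ and let $\mathrm{Pa}(i)$ be the set of parents of the node $i$ in $G$. A Gaussian vector $X$ is positively DAG dependent with respect to $G$ if it admits the stochastic representation $X_i=\sum_{j\in \mathrm{Pa}(i)}\Lambda_{ij}X_j+\varepsilon_i$ for all $i=1,\ldots,m$, where all $\Lambda_{ij}\in\mathbb{R}$ are nonnegative and the $\varepsilon_i\sim N(0,\sigma_i^2)$ are mutually independent.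
   Formalization: Positive DAG dependence is stated for the centered vector X − E X, since the centered noises force E X = 0 while CIS is translation invariant (X₁ ~ N(1,1) is a counterexample); CIS is read as monotonicity of some version of the conditional law. *)

(* Defs.v *)
From HB Require Import structures.
From mathcomp Require Import all_boot all_order all_algebra.
From mathcomp Require Import all_classical all_reals all_analysis measurable_realfun.

Set Implicit Arguments.
Unset Strict Implicit.
Unset Printing Implicit Defensive.

Import Order.TTheory GRing.Theory Num.Theory.

Local Open Scope classical_set_scope.
Local Open Scope ring_scope.

Section Vectors.
Context d (T : measurableType d) (R : realType) (P : probability T R).

(* The law N(mu, s^2).  The case s = 0 is treated apart because [normal_prob]
   is the uniform law on [0, 1] there, not the point mass at mu. *)
Definition has_normal_law (Y : {RV P >-> R}) (mu s : R) : Prop :=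
  forall B : set R, measurable B ->
    distribution P Y B = if s == 0 then \d_mu B else normal_prob mu s B.

Definition mutually_independent (I : finType) (Y : I -> {RV P >-> R}) : Prop :=
  forall (J : {set I}) (B : I -> set R),
    (forall i, i \in J -> measurable (B i)) ->
    P (\bigcap_(i in [set` J]) Y i @^-1` B i) =
    (\prod_(i in J) P (Y i @^-1` B i))%E.

(* X = mu + A Z with Z a standard normal vector of arbitrary dimension k;
   A need not have full rank.  Taking Z on the space of X is no restriction for
   a nondegenerate X: A can be chosen square invertible, and then
   Z = A^-1 (X - mu). *)
Definition gaussian_vector m (X : 'I_m -> {RV P >-> R}) : Prop :=
  exists (k : nat) (mu : 'I_m -> R) (A : 'M[R]_(m, k))
         (Z : 'I_k -> {RV P >-> R}),
    [/\ mutually_independent Z,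
        forall j, has_normal_law (Z j) 0 1 &
        forall i w, X i w = mu i + \sum_(j < k) A i j * Z j w].

Definition covariance_matrix m (X : 'I_m -> {RV P >-> R}) : 'M[R]_m :=
  \matrix_(i, j) fine (covariance P (X i) (X j)).

(* The noises of a DAG representation have mean zero, which forces the vector
   itself to have mean zero; a vector with another mean is compared with such a
   representation after centering.  If E X = 0, then [centered X = X]. *)
Definition centered m (X : 'I_m -> {RV P >-> R}) : 'I_m -> {RV P >-> R} :=
  fun i => (X i \- cst (fine 'E_P[X i]))%R.

(* kappa is a version of the conditional law of Y given W, i.e.
   kappa x B = P(Y \in B | W = x). *)
Definition is_conditional_law d' (T' : measurableType d')
    (Y : T -> R) (W : T -> T') (kappa : R.-pker T' ~> R) : Prop :=
  forall (A : set T') (B : set R), measurable A -> measurable B ->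
    P (W @^-1` A `&` Y @^-1` B) =
    (\int[P]_(w in W @^-1` A) kappa (W w) B)%E.

(* (X_j)_(j < i); since indices start at 0, i is also the number of
   predecessors of i. *)
Definition past m (X : 'I_m -> {RV P >-> R}) (i : 'I_m) (w : T) : i.-tuple R :=
  [tuple X (widen_ord (ltnW (ltn_ord i)) j) w | j < i].

(* Conditional laws are determined only up to null sets of the conditioning
   vector, so monotonicity is required of some version; for a nondegenerate
   Gaussian vector this is monotonicity of the usual Gaussian one, which is
   the weakly continuous version. *)
Definition cis m (X : 'I_m -> {RV P >-> R}) : Prop :=
  forall i : 'I_m, exists kappa : R.-pker (i.-tuple R) ~> R,
    is_conditional_law (X i) (past X i) kappa /\
    forall (t : R) (x y : i.-tuple R),
      (forall j, tnth x j <= tnth y j) ->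
      (kappa x `[t, +oo[%classic <= kappa y `[t, +oo[%classic)%E.

End Vectors.

Definition positive_definite (R : realType) m (S : 'M[R]_m) : Prop :=
  S^T = S /\ forall v : 'rV[R]_m, v != 0 -> 0 < (v *m S *m v^T) 0 0.

Record dag m := Dag {
  arrow :> rel 'I_m;
  arrow_acyclic : forall c : seq 'I_m, c != [::] -> ~~ cycle arrow c }.

Lemma ltn_acyclic m (c : seq 'I_m) :
  c != [::] -> ~~ cycle (fun i j : 'I_m => (i < j)%N) c.
Proof.
case: c => // x p _ /=.
apply/negP => /order_path_min => /(_ (fun a b c => @ltn_trans a b c)).
by rewrite all_rcons ltnn.
Qed.

Definition full_dag m : dag m := Dag (@ltn_acyclic m).

Definition positively_dag_dependent d (T : measurableType d) (R : realType)
    (P : probability T R) m (G : dag m) (X : 'I_m -> {RV P >-> R}) : Prop :=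
  exists (Lambda : 'M[R]_m) (sigma : 'I_m -> R) (eps : 'I_m -> {RV P >-> R}),
    [/\ forall i j, G j i -> 0 <= Lambda i j,
        mutually_independent eps,
        forall i, has_normal_law (eps i) 0 (sigma i) &
        forall i w, X i w = \sum_(j | G j i) Lambda i j * X j w + eps i w].

(* Main.v *)
Require Import Defs.
From HB Require Import structures.
From mathcomp Require Import all_boot all_order all_algebra.
From mathcomp Require Import all_classical all_reals all_analysis.
From mathcomp Require Import measurable_realfun.
From mathcomp Require Import ring lra.

Set Implicit Arguments.
Unset Strict Implicit.
Unset Printing Implicit Defensive.
Import Order.TTheory GRing.Theory Num.Theory.
Import numFieldNormedType.Exports.
Local Open Scope classical_set_scope.
Local Open Scope ring_scope.

(** Write the centered vector as X = A Z with Z a standard normal vector.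

    Reduction to a triangular A.  The law of a pair of independent standard
    normal variables is invariant under plane rotations
    ([normal_prob_rotation]), so replacing two coordinates of Z by a rotation
    of them yields another standard normal vector
    ([standard_normal_givens]).  Givens rotations therefore turn A into a
    lower triangular matrix L without leaving the family of Gaussian
    representations ([gaussian_triangularization]).  Positive definiteness of
    the covariance makes the rows of A independent, hence L is invertible on
    its first m columns and each Z_j with j < i is a combination of the X_l
    with l < i.  The i-th row of X = L Z then reads
    X_i = sum_(j < i) Lambda_ij X_j + L_ii Z_i with L_ii != 0
    ([gaussian_sequential_regression]): every nondegenerate Gaussian vector has
    a representation of the required form, except for the sign of Lambda.

    The equivalence thus concerns signs only.  In such a representation the
    noise of X_i is independent of the past (X_j)_(j < i)
    ([regression_past_independent]), so the law of X_i given the past is a fixed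
    law translated by an affine function of the past with slopes Lambda_ij.
    If the slopes are nonnegative, this version of the conditional law is
    stochastically nondecreasing, which is CIS
    ([nonnegative_regression_cis]).  Conversely, CIS in any version yields an
    inequality between the averages over two events that prescribe the past in
    boxes A1 <= A2 ([cis_box_exchange]).  All boxes have positive probability
    because the noises are nondegenerate; if Lambda_ij < 0, then two small boxes
    that differ mainly in their j-th coordinate contradict this inequality,
    since a nondegenerate normal law has strictly decreasing tails
    ([cis_nonnegative_regression]).  Working with boxes avoids any discussion
    of null sets and of the uniqueness of conditional laws. *)

(** * Affine change of variables and densities *)

(** [pushforward] is only a set function: its measure structure depends on a
    measurability proof, which this definition carries along. *)
Definition image_measure d1 d2 (T1 : measurableType d1) (T2 : measurableType d2)
    (R : realType) (m : {measure set T1 -> \bar R}) (f : T1 -> T2)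
    (mf : measurable_fun setT f) : {measure set T2 -> \bar R} :=
  measure_function_pushforward__canonical__measure_function_Measure m mf.

Section lebesgue_affine.
Context {R : realType}.
Local Notation mu := (@lebesgue_measure R).
Local Open Scope ereal_scope.

Let aff (a b x : measurableTypeR R) : measurableTypeR R := (a * x + b)%R.

Let measurable_aff a b : measurable_fun setT (aff a b).
Proof. by apply: measurable_funD => //; exact: measurable_funM. Qed.

(** The right-hand side is a measure in A, so it suffices to compare both sides
    on half-open intervals. *)
Lemma lebesgue_measure_affine (a b : R) (a0 : (a != 0)%R) (A : set R) :
  measurable A ->
  mu A = `|a|%:E * mu [set x | A (a * x + b)%R].
Proof.
move=> mA.
pose k : {nonneg R} := NngNum (normr_ge0 a).
pose nu : {measure set (measurableTypeR R) -> \bar R} :=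
  mscale k (image_measure mu (measurable_aff a b)).
suff : mu A = nu A by [].
apply: (@lebesgue_measure_unique R nu) => // _ [[l r]] _ <-.
have -> : nu `]l, r]%classic = `|a|%:E * mu [set x | (a * x + b)%R \in `]l, r]].
  by rewrite /nu/= /mscale/= /pushforward.
have [a_gt0|a_lt0|aE] := ltgtP 0%R a; last by rewrite -aE eqxx in a0.
- have -> : [set x | (a * x + b)%R \in `]l, r]] =
            `]((l - b) / a)%R, ((r - b) / a)%R]%classic.
    apply/seteqP; split => x /=; rewrite !in_itv/= ltr_pdivrMr//
      ler_pdivlMr// mulrC ltrBlDr lerBrDr//.
  rewrite !lebesgue_measure_itv/= !lte_fin ltr_pM2r ?invr_gt0// ltrD2r.
  case: ifP => _; last by rewrite mule0.
  by rewrite gtr0_norm// -!EFinD -EFinM; congr (_%:E); field.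
- have -> : [set x | (a * x + b)%R \in `]l, r]] =
            `[((r - b) / a)%R, ((l - b) / a)%R[%classic.
    apply/seteqP; split => x /=; rewrite !in_itv/= ltr_ndivlMr//
      ler_ndivrMr// mulrC ltrBlDr lerBrDr// andbC//.
  rewrite !lebesgue_measure_itv/= !lte_fin ltr_nM2r ?invr_lt0// ltrD2r.
  case: ifP => _; last by rewrite mule0.
  by rewrite ltr0_norm// -!EFinD -EFinM; congr (_%:E); field.
Qed.

Lemma ge0_integral_affine (a b : R) (f : R -> \bar R) : (a != 0)%R ->
  measurable_fun setT f -> (forall x, 0 <= f x) ->
  \int[mu]_x f x = `|a|%:E * \int[mu]_x f (a * x + b)%R.
Proof.
move=> a0 mf f0.
pose k : {nonneg R} := NngNum (normr_ge0 a).
pose nu : {measure set (measurableTypeR R) -> \bar R} :=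
  image_measure mu (measurable_aff a b).
transitivity (\int[mscale k nu]_x f x).
  apply: eq_measure_integral => A mA _.
  exact: (lebesgue_measure_affine b a0 mA).
rewrite ge0_integral_mscale//; congr (_ * _).
by rewrite /nu ge0_integral_pushforward.
Qed.

End lebesgue_affine.

Section density.
Context d (T : measurableType d) (R : realType).
Variables (mu nu : {measure set T -> \bar R}) (g : T -> R).
Hypotheses (mg : measurable_fun setT g) (g0 : forall x, 0 <= g x).
Hypothesis nuE : forall A, measurable A ->
  nu A = (\int[mu]_(x in A) (g x)%:E)%E.
Local Open Scope ereal_scope.
Import HBNNSimple.

Let ge0_integral_density_nnsfun (h : {nnsfun T >-> R}) :
  \int[nu]_x (h x)%:E = \int[mu]_x ((h x)%:E * (g x)%:E).
Proof.
under [LHS]eq_integral do rewrite fimfunE -fsumEFin//.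
rewrite ge0_integral_fsum//; last 2 first.
  by move=> r; exact/measurable_EFinP/measurableT_comp.
  by move=> n x _; rewrite EFinM nnfun_muleindic_ge0.
under [RHS]eq_integral.
  move=> x _; rewrite fimfunE -fsumEFin// ge0_mule_fsuml; last first.
    by move=> r; rewrite EFinM nnfun_muleindic_ge0.
  over.
rewrite [RHS]ge0_integral_fsum//; last 2 first.
  move=> r; apply: emeasurable_funM; last exact/measurable_EFinP.
  exact/measurable_EFinP/measurableT_comp.
  move=> n x _; rewrite mule_ge0//; last by rewrite lee_fin.
  by rewrite EFinM nnfun_muleindic_ge0.
apply: eq_fsbigr => r _.
rewrite integralZl_indic_nnsfun//= integral_indic// setIT nuE//.
have [r0|r0] := leP 0%R r; last first.
  rewrite preimage_nnfun0//= integral_set0 mule0; apply/esym/integral0_eq.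
  by move=> x _; rewrite indicE in_set0 mulr0 mul0e.
under [RHS]eq_integral do rewrite EFinM -muleA.
rewrite ge0_integralZl//; last 2 first.
- apply: emeasurable_funM; last exact/measurable_EFinP.
  exact/measurable_EFinP.
- by move=> x _; rewrite mule_ge0// lee_fin.
congr (_ * _); rewrite integral_mkcond; apply: eq_integral => x _.
rewrite patchE indicE.
by case: ifP => _; rewrite ?mul1e ?mul0e.
Qed.

Lemma ge0_integral_density (f : T -> \bar R) :
  measurable_fun setT f -> (forall x, 0 <= f x) ->
  \int[nu]_x f x = \int[mu]_x (f x * (g x)%:E).
Proof.
move=> mf f0.
pose f_ := nnsfun_approx measurableT mf.
transitivity (limn (fun n => \int[nu]_x (f_ n x)%:E)).
  rewrite -monotone_convergence//=.
  - apply: eq_integral => x _; apply/esym/cvg_lim => //=.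
    exact: cvg_nnsfun_approx.
  - by move=> n; exact/measurable_EFinP/measurable_funTS.
  - by move=> n x _; rewrite lee_fin.
  - by move=> x _ m n mn; rewrite lee_fin; exact/lefP/nd_nnsfun_approx.
under eq_fun do rewrite ge0_integral_density_nnsfun.
rewrite -monotone_convergence//=.
- apply: eq_integral => x _; apply/cvg_lim => //=.
  apply: cvgeZr => //; exact: cvg_nnsfun_approx.
- move=> n; apply: emeasurable_funM; last exact/measurable_EFinP.
  exact/measurable_EFinP/measurable_funTS.
- by move=> n x _; rewrite mule_ge0 ?lee_fin.
- move=> x _ m n mn; apply: lee_wpmul2r; first by rewrite lee_fin.
  by rewrite lee_fin; exact/lefP/nd_nnsfun_approx.
Qed.

End density.

(** * The normal law on the line *)

Section standard_normal.
Context {R : realType}.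
Local Notation mu := (@lebesgue_measure R).
Local Notation N := (@normal_prob R 0 1).
Local Notation phi := (@normal_pdf R 0 1).

Lemma ge0_integral_normal_prob (m s : R) (f : R -> \bar R) :
  measurable_fun setT f -> (forall x, (0 <= f x)%E) ->
  (\int[normal_prob m s]_x f x = \int[mu]_x (f x * (normal_pdf m s x)%:E))%E.
Proof.
move=> mf f0; apply: ge0_integral_density => //.
- exact: measurable_normal_pdf.
- by move=> x; exact: normal_pdf_ge0.
Qed.

Lemma normal_pdf_std (x : R) :
  phi x = normal_peak 1 * expR (- (x ^+ 2 / 2)).
Proof.
by rewrite normal_pdfE ?oner_neq0// /normal_fun subr0 expr1n mulNr.
Qed.

Lemma normal_pdf_scale (a x : R) : a != 0 ->
  normal_pdf 0 a (a * x) = `|a|^-1 * phi x.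
Proof.
move=> a0; rewrite normal_pdf_std normal_pdfE// /normal_fun/normal_peak subr0.
rewrite mulrA; congr (_ * _); last first.
  by congr expR; rewrite -mulr_natl; field.
rewrite -[in LHS]mulrnAr sqrtrM ?sqr_ge0// sqrtr_sqr expr1n mul1r.
by rewrite invfM.
Qed.

Lemma normal_prob_scale (a : R) (B : set R) : a != 0 -> measurable B ->
  N [set x | B (a * x)] = normal_prob 0 a B.
Proof.
move=> a0 mB.
have mf : measurable_fun setT (fun x : R => (\1_B x * normal_pdf 0 a x)%:E).
  apply/measurable_EFinP/measurable_funM; last exact: measurable_normal_pdf.
  exact: measurable_indic.
have normal_probE m s (D : set R) :
    normal_prob m s D = (\int[mu]_x (\1_D x * normal_pdf m s x)%:E)%E.
  rewrite /normal_prob integral_mkcond; apply: eq_integral => x _.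
  by rewrite patchE indicE; case: ifP; rewrite ?mul1r ?mul0r.
rewrite !normal_probE (ge0_integral_affine 0 a0 mf); last first.
  by move=> x; rewrite lee_fin mulr_ge0// normal_pdf_ge0.
rewrite -ge0_integralZl//; last 2 first.
- suff : measurable_fun setT ((fun x => (\1_B x * normal_pdf 0 a x)%:E) \o
      (fun x : R => a * x + 0)) by [].
  apply: measurableT_comp => //.
  by apply: measurable_funD => //; exact: measurable_funM.
- by move=> x _; rewrite lee_fin mulr_ge0// normal_pdf_ge0.
apply: eq_integral => x _; rewrite addr0 -EFinM normal_pdf_scale//.
by rewrite mulrCA mulVKf// normr_eq0.
Qed.

Lemma normal_prob_itv_gt0 (s l r : R) : s != 0 -> l < r ->
  (0 < normal_prob 0 s `]l, r[)%E.
Proof.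
move=> s0 lr; pose M := `|l| + `|r|.
pose c := normal_peak s * expR (- (M ^+ 2 / (s ^+ 2 *+ 2))).
have c0 : 0 < c by rewrite mulr_gt0 ?expR_gt0// normal_peak_gt0.
apply: (@lt_le_trans _ _ (\int[mu]_(x in `]l, r[) c%:E)%E).
  rewrite integral_cst//= lebesgue_measure_itv/= lte_fin lr -EFinD -EFinM.
  by rewrite lte_fin mulr_gt0// subr_gt0.
apply: ge0_le_integral => //=.
- by move=> x _; rewrite lee_fin ltW.
- by apply/measurable_EFinP/measurable_funTS; exact: measurable_normal_pdf.
move=> x; rewrite in_itv/= => /andP[lx xr]; rewrite lee_fin normal_pdfE//.
rewrite ler_pM2l ?normal_peak_gt0// /normal_fun subr0 ler_expR mulNr lerN2.
rewrite ler_pM2r ?invr_gt0 ?pmulrn_lgt0 ?exprn_even_gt0//.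
rewrite -[leLHS]real_normK ?num_real// lerXn2r ?nnegrE ?addr_ge0//.
rewrite /M; have := ler_norm l; have := ler_norm r.
have := ler_norm (- l); have := ler_norm (- r); rewrite !normrN => ? ? ? ?.
rewrite ler_norml; have := normr_ge0 l; have := normr_ge0 r => ? ?.
by apply/andP; split; lra.
Qed.

Lemma normal_prob_tail_lt (s a b : R) : s != 0 -> a < b ->
  (normal_prob 0 s `[b, +oo[ < normal_prob 0 s `[a, +oo[)%E.
Proof.
move=> s0 ab.
have -> : `[a, +oo[%classic = `[a, b[%classic `|` `[b, +oo[%classic :> set R.
  rewrite -itv_bndbnd_setU//; by rewrite bnd_simp ltW.
rewrite measureU//; last first.
  rewrite -subset0 => x [] /=; rewrite !in_itv/= andbT => /andP[_ xb] bx.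
  by have := lt_le_trans xb bx; rewrite ltxx.
rewrite lteDr ?fin_num_measure//.
apply: lt_le_trans (normal_prob_itv_gt0 s0 ab) _.
by apply: le_measure; rewrite ?inE//; exact: subset_itv_oo_co.
Qed.

(** Comparison with the normal law of variance 2: since u <= exp u, the density
    satisfies x^2 exp(-x^2/2) <= 4 exp(-x^2/4). *)
Lemma normal_second_moment_lty : (\int[N]_x (x ^+ 2)%:E < +oo)%E.
Proof.
rewrite ge0_integral_normal_prob//; last 2 first.
  by apply/measurable_EFinP; exact: measurable_funX.
  by move=> x; rewrite lee_fin sqr_ge0.
pose s : R := Num.sqrt 2.
have s2 : s ^+ 2 = 2 by rewrite sqr_sqrtr.
have s0 : s != 0 by rewrite sqrtr_eq0 -ltNge.
pose C := 4 * normal_peak 1 / normal_peak s : R.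
apply: (@le_lt_trans _ _ (\int[mu]_x (C%:E * (normal_pdf 0 s x)%:E))%E).
  apply: ge0_le_integral => //=.
  - by move=> x _; rewrite -EFinM lee_fin mulr_ge0 ?sqr_ge0 ?normal_pdf_ge0.
  - apply/measurable_EFinP/measurable_funM; first exact: measurable_funX.
    exact: measurable_normal_pdf.
  - by apply/measurable_EFinP/measurable_funM => //; exact: measurable_normal_pdf.
  move=> x _; rewrite -!EFinM lee_fin normal_pdf_std normal_pdfE//.
  rewrite /normal_fun subr0 s2.
  have -> : C * (normal_peak s * expR (- x ^+ 2 / (2 *+ 2))) =
      normal_peak 1 * (4 * expR (- x ^+ 2 / (2 *+ 2))).
    by rewrite /C; field; rewrite gt_eqF ?normal_peak_gt0.
  rewrite mulrCA ler_pM2l ?normal_peak_gt0 ?oner_neq0//.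
  have -> : - (x ^+ 2 / 2) = - (x ^+ 2 / 4) - x ^+ 2 / 4 by field.
  have -> : - x ^+ 2 / (2 *+ 2) = - (x ^+ 2 / 4).
    by rewrite -mulr_natl; field.
  rewrite expRD mulrCA [leRHS]mulrC ler_pM2l ?expR_gt0//.
  rewrite expRN ler_pdivrMr ?expR_gt0//.
  by have := expR_ge1Dx (x ^+ 2 / 4); lra.
rewrite ge0_integralZl//=; last 3 first.
- by apply/measurable_EFinP; exact: measurable_normal_pdf.
- by move=> x _; rewrite lee_fin normal_pdf_ge0.
- by rewrite lee_fin !mulr_ge0 ?invr_ge0 ?normal_peak_ge0.
by rewrite integral_normal_pdf mule1 ltry.
Qed.

End standard_normal.

(** * Rotation invariance of a pair of independent normal variables *)

Section rotation.
Context {R : realType}.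
Local Notation mu := (@lebesgue_measure R).
Local Notation N := (@normal_prob R 0 1).
Local Notation phi := (@normal_pdf R 0 1).
Variables (c s : R) (B C : set R).
Hypotheses (cs1 : c ^+ 2 + s ^+ 2 = 1) (s0 : s != 0).
Hypotheses (mB : measurable B) (mC : measurable C).

Let phiM (x y x' y' : R) : x ^+ 2 + y ^+ 2 = x' ^+ 2 + y' ^+ 2 ->
  phi x * phi y = phi x' * phi y'.
Proof.
move=> E; rewrite !normal_pdf_std mulrACA [RHS]mulrACA -!expRD.
by rewrite -!opprD -!mulrDl E.
Qed.

(* f is the integrand in the original coordinates, g after the substitution
   u = c x + s y at fixed x, and h after the further substitution
   v = - s x + c y = (c u - x) / s at fixed u. *)
Let f (x y : R) : R :=
  \1_B (c * x + s * y) * \1_C (- s * x + c * y) * (phi x * phi y).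
Let g (x u : R) : R :=
  \1_B u * \1_C ((c * u - x) / s) * (phi x * phi ((u - c * x) / s)).
Let h (u v : R) : R := \1_B u * \1_C v * (phi u * phi v).

Let m1 (D : set R) : measurable D -> measurable_fun setT (\1_D : R -> R).
Proof. by move=> mD; exact: measurable_indic. Qed.

Let mphi : measurable_fun setT phi := measurable_normal_pdf 0 1.

Let ind_ge0 (D : set R) x : 0 <= \1_D x :> R.
Proof. by rewrite indicE. Qed.

Let mg : measurable_fun setT (fun z : R * R => g z.1 z.2).
Proof.
apply: measurable_funM; apply: measurable_funM.
- by apply: (measurableT_comp (m1 mB)).
- apply: (measurableT_comp (m1 mC)); apply: measurable_funM => //.
  by apply: measurable_funB => //; apply: measurable_funM.
- by apply: (measurableT_comp mphi).
- apply: (measurableT_comp mphi); apply: measurable_funM => //.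
  by apply: measurable_funB => //; apply: measurable_funM.
Qed.

Let mh : measurable_fun setT (fun z : R * R => h z.1 z.2).
Proof.
apply: measurable_funM; apply: measurable_funM.
- by apply: (measurableT_comp (m1 mB)).
- by apply: (measurableT_comp (m1 mC)).
- by apply: (measurableT_comp mphi).
- by apply: (measurableT_comp mphi).
Qed.

Let g0 x y : 0 <= g x y.
Proof. by rewrite !mulr_ge0// normal_pdf_ge0. Qed.

Let h0 x y : 0 <= h x y.
Proof. by rewrite !mulr_ge0// normal_pdf_ge0. Qed.

Let msec (k : R -> R -> R) x :
  measurable_fun setT (fun z : R * R => k z.1 z.2) ->
  measurable_fun setT (fun y => (k x y)%:E).
Proof.
move=> mk; apply/measurable_EFinP.
have := measurableT_comp mk (@measurable_pair1 _ _ R R x).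
exact.
Qed.

Let int_f x : (\int[mu]_y (f x y)%:E = `|s|^-1%:E * \int[mu]_u (g x u)%:E)%E.
Proof.
rewrite (ge0_integral_affine (c * x) s0 (msec x mg)); last first.
  by move=> u; rewrite lee_fin.
rewrite muleA -EFinM mulVf ?normr_eq0// mul1e.
apply: eq_integral => y _; congr (_%:E); rewrite /f /g [s * y + _]addrC.
have -> : (c * (c * x + s * y) - x) / s = - s * x + c * y.
  have -> : c * (c * x + s * y) - x =
    (- s * x + c * y) * s + (c ^+ 2 + s ^+ 2 - 1) * x by ring.
  by rewrite cs1 subrr mul0r addr0 mulfK.
by congr (_ * (_ * phi _)); field.
Qed.

Let int_g u : (\int[mu]_x (g x u)%:E = `|s|%:E * \int[mu]_v (h u v)%:E)%E.
Proof.
have ns0 : - s^-1 != 0 by rewrite oppr_eq0 invr_eq0.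
rewrite (ge0_integral_affine (c * u / s) ns0 (msec u mh)); last first.
  by move=> v; rewrite lee_fin.
rewrite muleA -EFinM normrN normfV mulfV ?normr_eq0// mul1e.
apply: eq_integral => x _; congr (_%:E); rewrite /h /g.
have -> : - s^-1 * x + c * u / s = (c * u - x) / s by field.
congr (_ * _); apply: phiM; rewrite !expr_div_n.
apply: (@mulIf _ (s ^+ 2)); first by rewrite expf_neq0.
rewrite !mulrDl !divfK ?expf_neq0//.
have -> : x ^+ 2 * s ^+ 2 + (u - c * x) ^+ 2 =
  (c ^+ 2 + s ^+ 2) * x ^+ 2 + u ^+ 2 - 2 * c * u * x by ring.
have -> : u ^+ 2 * s ^+ 2 + (c * u - x) ^+ 2 =
  (c ^+ 2 + s ^+ 2) * u ^+ 2 + x ^+ 2 - 2 * c * u * x by ring.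
by rewrite cs1; ring.
Qed.

Let N_indic (D : set R) :
  N D = (\int[mu]_x (\1_D x * phi x)%:E)%E.
Proof.
rewrite /normal_prob integral_mkcond; apply: eq_integral => x _.
by rewrite patchE indicE; case: ifP; rewrite ?mul1r ?mul0r.
Qed.

Let int_h : (\int[mu]_u \int[mu]_v (h u v)%:E = N B * N C)%E.
Proof.
transitivity (\int[mu]_u ((\1_B u * phi u)%:E * N C))%E.
  apply: eq_integral => u _; rewrite N_indic -ge0_integralZl//; last 3 first.
  - by apply/measurable_EFinP/measurable_funM => //; exact: m1.
  - by move=> x _; rewrite lee_fin mulr_ge0// normal_pdf_ge0.
  - by rewrite lee_fin mulr_ge0// normal_pdf_ge0.
  by apply: eq_integral => v _; rewrite /h -EFinM; congr (_%:E); ring.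
rewrite ge0_integralZr//; last 2 first.
- by apply/measurable_EFinP/measurable_funM => //; exact: m1.
- by move=> x _; rewrite lee_fin mulr_ge0// normal_pdf_ge0.
by rewrite -N_indic.
Qed.

(** A rotation is the composition of two substitutions that are affine in one
    variable (this needs s != 0) with an exchange of the order of integration;
    the Jacobians |s| and 1/|s| cancel, and the joint density depends on
    x^2 + y^2 only. *)
Lemma normal_prob_rotation :
  ((N \x N) [set z | B (c * z.1 + s * z.2)%R /\ C (- s * z.1 + c * z.2)%R]
   = N B * N C)%E.
Proof.
set S := [set z | _].
have mS : measurable S.
  have -> : S = (fun z : R * R => c * z.1 + s * z.2) @^-1` B `&`
     (fun z : R * R => - s * z.1 + c * z.2) @^-1` C by [].
  by apply: measurableI; rewrite -[X in measurable X]setTI;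
    apply: (measurable_funD _ _) => //; apply: measurable_funM.
rewrite /product_measure1/= ge0_integral_normal_prob//; last first.
  exact: (measurable_fun_xsection N mS).
transitivity (\int[mu]_x \int[mu]_y (f x y)%:E)%E.
  apply: eq_integral => x _.
  rewrite N_indic muleC -ge0_integralZl//; last 3 first.
  - apply/measurable_EFinP/measurable_funM => //.
    by apply: m1; exact: measurable_xsection.
  - by move=> y _; rewrite lee_fin mulr_ge0// normal_pdf_ge0.
  - by rewrite lee_fin normal_pdf_ge0.
  apply: eq_integral => y _; rewrite -EFinM; congr (_%:E).
  rewrite /f mulrCA; congr (_ * _).
  rewrite !indicE -natrM mulnb; congr (nat_of_bool _)%:R.
  by apply/idP/andP => [|[]]; rewrite mem_xsection// !inE.
have mgE : measurable_fun setT (fun z : R * R => (g z.1 z.2)%:E).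
  exact/measurable_EFinP.
have gE0 (z : R * R) : (0 <= (g z.1 z.2)%:E)%E by rewrite lee_fin.
transitivity (`|s|^-1%:E * \int[mu]_x \int[mu]_u (g x u)%:E)%E.
  rewrite -ge0_integralZl//; last 2 first.
  - exact (measurable_fun_fubini_tonelli_F (m2 := mu) _ mgE gE0).
  - by move=> x _; apply: integral_ge0 => u _; rewrite lee_fin.
  by apply: eq_integral => x _; rewrite int_f.
have -> : (\int[mu]_x \int[mu]_u (g x u)%:E =
           \int[mu]_u \int[mu]_x (g x u)%:E)%E.
  exact: (fubini_tonelli (m1 := mu) (m2 := mu) _ mgE gE0).
rewrite -int_h -ge0_integralZl//; last 2 first.
- exact (measurable_fun_fubini_tonelli_G (m1 := mu) _ mgE gE0).
- by move=> u _; apply: integral_ge0 => x _; rewrite lee_fin.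
apply: eq_integral => u _.
by rewrite int_g muleA -EFinM mulVf ?normr_eq0// mul1e.
Qed.

End rotation.

(** * Independence *)

Lemma measurable_preimage d d' (T : measurableType d)
    (T' : measurableType d') (f : T -> T') B :
  measurable_fun setT f -> measurable B -> measurable (f @^-1` B).
Proof. by move=> mf mB; rewrite -[X in measurable X]setTI; exact: mf. Qed.

Section independence.
Context d (T : measurableType d) (R : realType) (P : probability T R).

Lemma mutually_independentP (I : finType) (Y : I -> {RV P >-> R}) :
  (forall B : I -> set R, (forall i, measurable (B i)) ->
    P [set w | forall i, B i (Y i w)] = (\prod_i P (Y i @^-1` B i))%E) ->
  mutually_independent Y.
Proof.
move=> H J B mB.
pose B' i := if i \in J then B i else setT.
have mB' i : measurable (B' i) by rewrite /B'; case: ifP => // /mB.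
have -> : \bigcap_(i in [set` J]) Y i @^-1` B i =
    [set w | forall i, B' i (Y i w)].
  apply/seteqP; split => [w H0 i|w H0 i /= iJ].
    by rewrite /B'; case: ifP => // iJ; exact: H0.
  by have := H0 i; rewrite /B' iJ.
rewrite H// [RHS]big_mkcond/=; apply: eq_bigr => i _; rewrite /B'.
by case: ifP => // _; rewrite preimage_setT probability_setT.
Qed.

Lemma mutually_independent_full (I : finType) (Y : I -> {RV P >-> R})
    (B : I -> set R) :
  mutually_independent Y -> (forall i, measurable (B i)) ->
  P [set w | forall i, B i (Y i w)] = (\prod_i P (Y i @^-1` B i))%E.
Proof.
move=> iY mB; have := iY [set: I]%SET B (fun i _ => mB i).
under [X in _ = X -> _]eq_bigl do rewrite finset.in_setT.
move=> <-; congr (P _); apply/seteqP; split => [w H i _|w H i]; first exact: H.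
by apply: H => /=; rewrite finset.in_setT.
Qed.

Lemma mutually_independent_comp (I : finType) (Y Y' : I -> {RV P >-> R})
    (f : I -> R -> R) :
  (forall i, measurable_fun setT (f i)) -> (forall i w, Y' i w = f i (Y i w)) ->
  mutually_independent Y -> mutually_independent Y'.
Proof.
move=> mf Y'E iY J B mB.
have E i : Y' i @^-1` B i = Y i @^-1` (f i @^-1` B i).
  by apply/seteqP; split => w /=; rewrite Y'E.
under eq_bigcapr do rewrite E.
rewrite iY//; last by move=> i iJ; apply: measurable_preimage => //; exact: mB.
by apply: eq_bigr => i _; rewrite E.
Qed.

Lemma mutually_independent_inj (I I' : finType) (g : I' -> I)
    (Y : I -> {RV P >-> R}) : injective g ->
  mutually_independent Y -> mutually_independent (Y \o g).
Proof.
move=> ginj iY J B mB.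
pose B' i := if [pick j | g j == i] is Some j then B j else setT.
have B'g j : B' (g j) = B j.
  rewrite /B'; case: pickP => [k /eqP/ginj -> //|/(_ j)]; by rewrite eqxx.
have := iY (g @: J)%SET B'.
rewrite big_imset/=; last by move=> ? ? _ _; exact: ginj.
under eq_bigr do rewrite B'g.
move=> <-; last by move=> _ /imsetP[j jJ ->]; rewrite B'g; exact: mB.
congr (P _); apply/seteqP; split => [w H _ /= /imsetP[j jJ ->]|w H j /= jJ].
  by rewrite B'g; exact: H.
by have := H (g j); rewrite /= B'g; apply; exact: imset_f.
Qed.

(** Both sides are finite measures in S that agree on rectangles.  The extra
    event E is what allows two coordinates of an independent family to be
    replaced while all the others are kept. *)
Lemma independent_pair d1 d2 (T1 : measurableType d1) (T2 : measurableType d2)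
    (U : {RV P >-> T1}) (V : {RV P >-> T2}) (E : set T) : measurable E ->
  (forall A B, measurable A -> measurable B ->
    P (E `&` (U @^-1` A `&` V @^-1` B)) =
    (P E * (distribution P U A * distribution P V B))%E) ->
  forall S, measurable S ->
  P (E `&` [set w | S (U w, V w)]) =
  (P E * (distribution P U \x distribution P V) S)%E.
Proof.
move=> mE H S mS.
have mUV : measurable_fun setT (fun w => (U w, V w)).
  by apply: measurable_fun_pair.
have fPE : P E \is a fin_num by rewrite fin_num_measure.
pose k : {nonneg R} := NngNum (fine_ge0 (measure_ge0 P E)).
pose m1 : {measure set (T1 * T2) -> \bar R} := image_measure (mrestr P mE) mUV.
pose m2 : {measure set (T1 * T2) -> \bar R} :=
  mscale k (distribution P U \x distribution P V)%E.
have -> : P (E `&` [set w | S (U w, V w)]) = m1 S by rewrite setIC.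
have -> : (P E * (distribution P U \x distribution P V) S = m2 S)%E.
  by rewrite /m2/= /mscale/= fineK.
pose G : set (set (T1 * T2)) :=
  [set A `*` B | A in measurable & B in measurable].
apply: (measure_unique G (fun=> setT)) => //.
- exact: measurable_prod_measurableType.
- move=> _ _ [A mA [B mB <-]] [A' mA' [B' mB' <-]]; rewrite -setXI.
  by exists (A `&` A'); [exact: measurableI|exists (B `&` B');
    [exact: measurableI|]].
- by move=> _; exists setT => //; exists setT => //; rewrite setXTT.
- by rewrite bigcup_const.
- move=> _ [A mA [B mB <-]].
  rewrite /m1 /m2/= /mscale/= /mrestr /pushforward/= product_measure1E// fineK//.
  by rewrite -H// setIC.
- move=> _; rewrite /m1/= /mrestr /pushforward preimage_setT setTI.
  by rewrite ltey_eq fPE.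
Qed.

End independence.

Section tuple_boxes.
Context {R : realType} (n : nat).

Definition tuple_box (B : 'I_n -> set R) : set (n.-tuple R) :=
  [set x | forall j, B j (tnth x j)].

Definition tuple_boxes : set (set (n.-tuple R)) :=
  [set tuple_box B | B in [set B | forall j, measurable (B j)]].

Lemma measurable_tuple_box (B : 'I_n -> set R) :
  (forall j, measurable (B j)) -> measurable (tuple_box B).
Proof.
move=> mB.
have -> : tuple_box B = \bigcap_(j in [set: 'I_n]) ((@tnth n R)^~ j @^-1` B j).
  by apply/seteqP; split => [x H j _|x H j]; [exact: H|exact: (H j)].
apply: fin_bigcap_measurable => // j _.
by apply: measurable_preimage => //; exact: measurable_tnth.
Qed.

(** The sigma-algebra on tuples is defined by the cylinders over one coordinate,
    which are not stable by intersection; boxes are. *)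
Lemma measurable_tupleE :
  (measurable : set (set (n.-tuple R))) = <<s tuple_boxes >>.
Proof.
apply/seteqP; split.
  apply: smallest_sub; first exact: smallest_sigma_algebra.
  move=> A; rewrite -bigcup_seq => -[/= j _ [B mB <-]].
  apply: sub_sigma_algebra; rewrite setTI.
  exists (fun j' => if j' == j then B else setT) => /=.
    by move=> j'; case: ifP.
  apply/seteqP; split => x /=; first by move=> /(_ j); rewrite eqxx.
  by move=> Bx j'; case: eqP => // ->.
apply: smallest_sub; first exact: sigma_algebra_measurable.
by move=> _ [B mB <-]; exact: measurable_tuple_box.
Qed.

Lemma tuple_boxes_setI_closed : setI_closed tuple_boxes.
Proof.
move=> _ _ [B mB <-] [C mC <-]; exists (fun j => B j `&` C j) => /=.
  by move=> j; apply: measurableI; [exact: mB|exact: mC].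
apply/seteqP; split => [x H|x [HB HC] j]; last by split; [exact: HB|exact: HC].
by split => j; case: (H j).
Qed.

Lemma tuple_box_setT : tuple_box (fun=> setT) = setT.
Proof. by apply/seteqP; split. Qed.

End tuple_boxes.

Section past_independence.
Context d (T : measurableType d) (R : realType) (P : probability T R).
Variables (m : nat) (Y : 'I_m -> {RV P >-> R}).

Lemma measurable_past (i : 'I_m) : measurable_fun setT (past Y i).
Proof.
apply/measurable_fun_tnthP => j.
rewrite (_ : _ \o _ = Y (widen_ord (ltnW (ltn_ord i)) j))//.
by apply/funext => w; rewrite /= tnth_mktuple.
Qed.

(** As functions of A both sides are finite measures; on boxes their equality is
    the product rule for the indices up to i. *)
Lemma past_independent (i : 'I_m) (A : set (i.-tuple R)) (B : set R) :
  mutually_independent Y -> measurable A -> measurable B ->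
  P (past Y i @^-1` A `&` Y i @^-1` B) =
  (P (past Y i @^-1` A) * P (Y i @^-1` B))%E.
Proof.
move=> iY mA mB.
pose E := Y i @^-1` B.
have mE : measurable E by exact: measurable_preimage.
have fPE : P E \is a fin_num by rewrite fin_num_measure.
pose k : {nonneg R} := NngNum (fine_ge0 (measure_ge0 P E)).
have mp : measurable_fun setT (past Y i) by exact: measurable_past.
pose m1 : {measure set (i.-tuple R) -> \bar R} := image_measure (mrestr P mE) mp.
pose m2 : {measure set (i.-tuple R) -> \bar R} := mscale k (image_measure P mp).
have -> : P (past Y i @^-1` A `&` E) = m1 A by [].
have -> : (P (past Y i @^-1` A) * P E = m2 A)%E.
  by rewrite /m2/= /mscale/= fineK// muleC.
apply: (measure_unique (@tuple_boxes R i) (fun=> setT)) => //.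
- exact: measurable_tupleE.
- exact: tuple_boxes_setI_closed.
- by move=> _; exists (fun=> setT) => //; exact: tuple_box_setT.
- by rewrite bigcup_const.
- move=> _ [C mC <-].
  rewrite /m1 /m2/= /mscale/= /mrestr /pushforward/= fineK//.
  pose w := widen_ord (ltnW (ltn_ord i)).
  pose D (j : 'I_m) := if insub (val j) is Some j' then C j' else B.
  have Dw j : D (w j) = C j by rewrite /D/= valK.
  have Di : D i = B by rewrite /D insubF// ltnn.
  have mD j : measurable (D j) by rewrite /D; case: insubP.
  have winj : injective w by move=> x y /(congr1 val) /= /val_inj.
  have iw : i \notin [set w j | j : 'I_i]%SET.
    apply/negP => /imsetP[j _ /(congr1 val)/= ij].
    by have := ltn_ord j; rewrite -ij ltnn.
  have PE : past Y i @^-1` tuple_box C =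
     \bigcap_(j in [set` [set w j | j : 'I_i]%SET]) Y j @^-1` D j.
    apply/seteqP; split => [t H _ /imsetP[j _ ->]|t H j] /=.
      by rewrite Dw; have := H j; rewrite tnth_mktuple.
    by rewrite tnth_mktuple -Dw; apply: H => /=; exact: imset_f.
  have -> : past Y i @^-1` tuple_box C `&` E =
     \bigcap_(j in [set` (i |: [set w j | j : 'I_i])%SET]) Y j @^-1` D j.
    rewrite PE; apply/seteqP; split => [t [H1 H2] j /=|t H].
      rewrite !finset.inE => /orP[/eqP ->|]; first by rewrite Di.
      exact: H1.
    split => [j /= jw|]; first by apply: H; rewrite /= !finset.inE jw orbT.
    by have := H i; rewrite /= Di; apply; rewrite /= !finset.inE eqxx.
  by rewrite PE !iY// finset.big_setU1//= Di.
- move=> _; rewrite /m1/= /mrestr /pushforward preimage_setT setTI.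
  by rewrite ltey_eq fPE.
Qed.

End past_independence.

(** * Givens rotations and triangularization of a Gaussian vector *)

Section givens.
Context d (T : measurableType d) (R : realType) (P : probability T R).
Local Notation N := (@normal_prob R 0 1).

Definition standard_normal_vector k (Z : 'I_k -> {RV P >-> R}) : Prop :=
  mutually_independent Z /\ forall j, has_normal_law (Z j) 0 1.

Lemma standard_normalE (Y : {RV P >-> R}) (B : set R) :
  has_normal_law Y 0 1 -> measurable B -> P (Y @^-1` B) = N B.
Proof.
by move=> NY mB; have := NY B mB; rewrite oner_eq0.
Qed.

Variables (k : nat) (Z : 'I_k -> {RV P >-> R}).

Definition givens (p q : 'I_k) (c s : R) : 'I_k -> {RV P >-> R} := fun j =>
  if j == p then ((cst c \* Z p \+ cst s \* Z q)%R : {RV P >-> R}) else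
  if j == q then ((cst (- s) \* Z p \+ cst c \* Z q)%R : {RV P >-> R}) else Z j.

Lemma givens_l p q c s w : givens p q c s p w = c * Z p w + s * Z q w.
Proof. by rewrite /givens eqxx. Qed.

Lemma givens_r p q c s w : p != q ->
  givens p q c s q w = - s * Z p w + c * Z q w.
Proof. by move=> pq; rewrite /givens [q == p]eq_sym (negbTE pq) eqxx. Qed.

Lemma givens_id p q c s j : j != p -> j != q -> givens p q c s j = Z j.
Proof. by move=> /negbTE jp /negbTE jq; rewrite /givens jp jq. Qed.

Variables (p q : 'I_k) (c s : R).
Hypotheses (pq : p != q) (cs1 : c ^+ 2 + s ^+ 2 = 1) (s0 : s != 0).
Hypothesis stdZ : standard_normal_vector Z.
Local Notation Z' := (givens p q c s).

Let stdZi j (B : set R) : measurable B -> P (Z j @^-1` B) = N B.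
Proof. by move=> mB; apply: standard_normalE => //; exact: stdZ.2. Qed.

Let others (B : 'I_k -> set R) : set T :=
  [set w | forall j, j != p -> j != q -> B j (Z j w)].

Let P_others (B : 'I_k -> set R) (A A' : set R) : (forall j, measurable (B j)) ->
  measurable A -> measurable A' ->
  P (others B `&` (Z p @^-1` A `&` Z q @^-1` A')) =
  ((\prod_(j | (j != p) && (j != q)) N (B j)) * (N A * N A'))%E.
Proof.
move=> mB mA mA'.
pose C j := if j == p then A else if j == q then A' else B j.
have mC j : measurable (C j) by rewrite /C; case: ifP => // _; case: ifP.
have -> : others B `&` (Z p @^-1` A `&` Z q @^-1` A') =
    [set w | forall j, C j (Z j w)].
  apply/seteqP; split => [w [H [Hp Hq]] j|w H].
    rewrite /C; case: eqP => [->//|/eqP jp]; case: eqP => [->//|/eqP jq].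
    exact: H.
  split => [j jp jq|].
    by have := H j; rewrite /C (negbTE jp) (negbTE jq).
  have := H p; have := H q.
  by rewrite /C eqxx [q == p]eq_sym (negbTE pq) eqxx.
rewrite mutually_independent_full//; last exact: stdZ.1.
rewrite (bigD1 p)//= (bigD1 q)/=; last by rewrite eq_sym.
rewrite !stdZi// muleA muleC; congr (_ * _)%E.
  by apply: eq_bigr => j /andP[jp jq]; rewrite stdZi// /C (negbTE jp) (negbTE jq).
by rewrite /C eqxx [q == p]eq_sym (negbTE pq) eqxx.
Qed.

Let P_rotated (B : 'I_k -> set R) (A A' : set R) : (forall j, measurable (B j)) ->
  measurable A -> measurable A' ->
  P (others B `&` (Z' p @^-1` A `&` Z' q @^-1` A')) =
  ((\prod_(j | (j != p) && (j != q)) N (B j)) * (N A * N A'))%E.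
Proof.
move=> mB mA mA'.
have PO : P (others B) = (\prod_(j | (j != p) && (j != q)) N (B j))%E.
  have := P_others mB measurableT measurableT.
  by rewrite !preimage_setT !setIT !probability_setT !mule1.
have mO : measurable (others B).
  have -> : others B =
      \bigcap_(j in [set j | (j != p) && (j != q)]) Z j @^-1` B j.
    apply/seteqP; split => [w H j /andP[]|w H j jp jq]; first exact: H.
    by apply: H; rewrite /= jp jq.
  apply: fin_bigcap_measurable => [|j _]; last exact: measurable_preimage.
  exact: finite_finset.
have prodE S : measurable S ->
    (distribution P (Z p) \x distribution P (Z q))%E S = (N \x N)%E S.
  move=> mS.
  (* [normal_prob] is a measure on [measurableTypeR R], whose display is not that
     of R, so the product law is transported along the identity map. *)
  pose GR := measurableTypeR R.
  have mid : measurable_fun setT (fun z : R * R => (z.1 : GR, z.2 : GR)).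
    have mId : measurable_fun setT (fun x : R => x : GR).
      by move=> _ A1 mA1; rewrite setTI; exact: mA1.
    apply: measurable_fun_pair.
      exact: (measurableT_comp mId measurable_fst).
    exact: (measurableT_comp mId measurable_snd).
  apply/esym.
  apply: (@product_measure_unique _ _ GR GR R N N (image_measure
    (distribution P (Z p) \x distribution P (Z q))%E mid)) => // A1 A2 mA1 mA2.
  rewrite /= /pushforward/= product_measure1E//.
  by congr (_ * _)%E; exact: stdZi.
pose S := [set z : R * R | A (c * z.1 + s * z.2) /\ A' (- s * z.1 + c * z.2)].
have mS : measurable S.
  have -> : S = (fun z : R * R => c * z.1 + s * z.2) @^-1` A `&`
     (fun z : R * R => - s * z.1 + c * z.2) @^-1` A' by [].
  by apply: measurableI; apply: measurable_preimage => //;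
    apply: (measurable_funD _ _) => //; apply: measurable_funM.
have -> : others B `&` (Z' p @^-1` A `&` Z' q @^-1` A') =
    others B `&` [set w | S (Z p w, Z q w)].
  congr (_ `&` _); apply/seteqP; split => w; rewrite /preimage/= /S/=;
  by rewrite givens_l givens_r.
rewrite independent_pair//; last first.
  move=> A1 A2 mA1 mA2.
  by rewrite P_others// PO /distribution /pushforward !stdZi.
by rewrite prodE// PO normal_prob_rotation.
Qed.

Let P_givens (B : 'I_k -> set R) : (forall j, measurable (B j)) ->
  P [set w | forall j, B j (Z' j w)] = (\prod_j N (B j))%E.
Proof.
move=> mB.
have -> : [set w | forall j, B j (Z' j w)] =
    others B `&` (Z' p @^-1` B p `&` Z' q @^-1` B q).
  apply/seteqP; split => [w H|w [H [Hp Hq]] j].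
    split; last by split; exact: H.
    by move=> j jp jq; have := H j; rewrite givens_id.
  have [->//|jp] := eqVneq j p; have [->//|jq] := eqVneq j q.
  by rewrite givens_id//; exact: H.
rewrite P_rotated// [RHS](bigD1 p)//= [X in _ = (_ * X)%E](bigD1 q)/=; last first.
  by rewrite eq_sym.
by rewrite muleC muleA.
Qed.

(** Given the other coordinates, the events on the coordinates p and q form a
    rotated rectangle; by [independent_pair] its probability is the one under
    the product law, which [normal_prob_rotation] computes. *)
Lemma standard_normal_givens : standard_normal_vector Z'.
Proof.
have law j B : measurable B -> P (Z' j @^-1` B) = N B.
  move=> mB; pose C i := if i == j then B else setT.
  have mC i : measurable (C i) by rewrite /C; case: ifP.
  have := P_givens mC; rewrite (bigD1 j)//= [X in (_ * X)%E]big1; last first.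
    by move=> i /negbTE ij; rewrite /C ij probability_setT.
  rewrite {2}/C eqxx mule1 => <-; congr (P _); apply/seteqP; split => w /=.
    by move=> Bw i; rewrite /C; case: eqP => // ->.
  by move=> /(_ j); rewrite /C eqxx.
split.
  apply: mutually_independentP => B mB; rewrite P_givens//.
  by apply: eq_bigr => j _; rewrite law.
by move=> j B mB; rewrite oner_eq0 -(law j).
Qed.

End givens.

Section triangularization.
Context d (T : measurableType d) (R : realType) (P : probability T R).

Definition same_linear_image m k (A : 'M[R]_(m, k)) (Z : 'I_k -> {RV P >-> R})
    (A' : 'M[R]_(m, k)) (Z' : 'I_k -> {RV P >-> R}) : Prop :=
  forall i w, \sum_(j < k) A i j * Z j w = \sum_(j < k) A' i j * Z' j w.

(** The angle is chosen so that the rotation sends the two entries of row r to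
    (rho, 0).  The last two conclusions express that the columns other than
    p and q, and the zeros shared by p and q in another row, are preserved, so
    that successive eliminations do not destroy each other. *)
Lemma givens_eliminate m k (A : 'M[R]_(m, k)) (Z : 'I_k -> {RV P >-> R})
    (r : 'I_m) (p q : 'I_k) : p != q -> standard_normal_vector Z ->
  exists (A' : 'M[R]_(m, k)) (Z' : 'I_k -> {RV P >-> R}),
    [/\ standard_normal_vector Z', same_linear_image A Z A' Z',
        A' r q = 0,
        forall i j, j != p -> j != q -> A' i j = A i j &
        forall i, A i p = 0 -> A i q = 0 -> A' i p = 0 /\ A' i q = 0].
Proof.
move=> pq stdZ; have [Arq|Arq] := eqVneq (A r q) 0.
  by exists A, Z; split.
pose rho := Num.sqrt (A r p ^+ 2 + A r q ^+ 2).
have rho2 : rho ^+ 2 = A r p ^+ 2 + A r q ^+ 2.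
  by rewrite sqr_sqrtr// addr_ge0 ?sqr_ge0.
have rho0 : rho != 0.
  rewrite sqrtr_eq0 -ltNge ltr_wpDl ?sqr_ge0//.
  by rewrite exprn_even_gt0//= Arq orbT.
pose c := A r p / rho; pose s := A r q / rho.
have cs1 : c ^+ 2 + s ^+ 2 = 1.
  by rewrite /c /s !expr_div_n -mulrDl -rho2 divff// expf_neq0.
have s0 : s != 0 by rewrite mulf_neq0// invr_neq0.
pose A' := \matrix_(i < m, j < k) (if j == p then c * A i p + s * A i q else
  if j == q then - s * A i p + c * A i q else A i j).
have A'p i : A' i p = c * A i p + s * A i q by rewrite mxE eqxx.
have A'q i : A' i q = - s * A i p + c * A i q.
  by rewrite mxE [q == p]eq_sym (negbTE pq) eqxx.
have A'E i j : j != p -> j != q -> A' i j = A i j.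
  by move=> /negbTE jp /negbTE jq; rewrite mxE jp jq.
exists A', (givens Z p q c s); split => //.
- exact: standard_normal_givens.
- move=> i w; rewrite (bigD1 p)//= (bigD1 q)/=; last by rewrite eq_sym.
  rewrite [RHS](bigD1 p)//= [in RHS](bigD1 q)/=; last by rewrite eq_sym.
  rewrite !addrA; congr (_ + _); last first.
    by apply: eq_bigr => j /andP[jp jq]; rewrite A'E// givens_id.
  rewrite A'p A'q givens_l givens_r//.
  transitivity ((c ^+ 2 + s ^+ 2) * (A i p * Z p w + A i q * Z q w)).
    by rewrite cs1 mul1r.
  by ring.
- by rewrite A'q /s /c; ring.
- by move=> i Ap Aq; rewrite A'p A'q Ap Aq !mulr0 !addr0.
Qed.

(** The rows are treated in increasing order; in row r, the entries to the right
    of the diagonal are eliminated one by one by rotating their column with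
    column r.  The earlier rows vanish in both columns. *)
Lemma gaussian_triangularization m k (A : 'M[R]_(m, k))
    (Z : 'I_k -> {RV P >-> R}) : standard_normal_vector Z ->
  exists (L : 'M[R]_(m, k)) (Z' : 'I_k -> {RV P >-> R}),
    [/\ standard_normal_vector Z', same_linear_image A Z L Z' &
        forall (i : 'I_m) (j : 'I_k), (i < j)%N -> L i j = 0].
Proof.
move=> stdZ.
suff rows n : exists (L : 'M[R]_(m, k)) (Z' : 'I_k -> {RV P >-> R}),
    [/\ standard_normal_vector Z', same_linear_image A Z L Z' &
        forall (i : 'I_m) (j : 'I_k), (i < n)%N -> (i < j)%N -> L i j = 0].
  have [L [Z' [sZ' AL L0]]] := rows m.
  by exists L, Z'; split => // i j; exact: L0.
elim: n => [|r [L [Z' [sZ' AL L0]]]]; first by exists A, Z; split.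
have [mr|rm] := leqP m r.
  exists L, Z'; split => // i j _ ij.
  by apply: L0 => //; exact: leq_trans mr.
suff row_r n : exists (L' : 'M[R]_(m, k)) (Z'' : 'I_k -> {RV P >-> R}),
    [/\ standard_normal_vector Z'', same_linear_image A Z L' Z'',
        forall (i : 'I_m) (j : 'I_k), (i < r)%N -> (i < j)%N -> L' i j = 0 &
        forall (j : 'I_k), (r < j)%N -> (j < n)%N -> L' (Ordinal rm) j = 0].
  have [L' [Z'' [sZ'' AL' L'0 L'r]]] := row_r k.
  exists L', Z''; split => // i j; rewrite ltnS leq_eqVlt => /orP[/eqP ir|].
    by move=> ij; have -> : i = Ordinal rm by [apply: val_inj]; rewrite L'r -?ir.
  exact: L'0.
elim: n => [|q [L' [Z'' [sZ'' AL' L'0 L'r]]]]; first by exists L, Z'; split.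
(* There is nothing to eliminate on or left of the diagonal, nor beyond the last
   column. *)
have skip : (q <= r)%N || (k <= q)%N ->
    exists (L' : 'M[R]_(m, k)) (Z'' : 'I_k -> {RV P >-> R}),
    [/\ standard_normal_vector Z'', same_linear_image A Z L' Z'',
        forall (i : 'I_m) (j : 'I_k), (i < r)%N -> (i < j)%N -> L' i j = 0 &
        forall (j : 'I_k), (r < j)%N -> (j < q.+1)%N -> L' (Ordinal rm) j = 0].
  move=> qk; exists L', Z''; split => // j rj.
  rewrite ltnS leq_eqVlt => /orP[/eqP jq|]; last exact: L'r.
  by move: qk (ltn_ord j); rewrite -jq leqNgt rj/= leqNgt => /negbTE ->.
have [qr|rq] := leqP q r; first by apply: skip; rewrite qr.
have [kq|qk] := leqP k q; first by apply: skip; rewrite kq orbT.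
pose p0 := Ordinal (ltn_trans rq qk); pose q0 := Ordinal qk.
have pq : p0 != q0 by rewrite -val_eqE/= neq_ltn rq.
have [A' [Z3 [sZ3 AL3 A'rq A'E A'0]]] :=
  givens_eliminate L' (Ordinal rm) pq sZ''.
exists A', Z3; split => //.
- by move=> i w; rewrite AL'.
- move=> i j ir ij.
  have [L'p L'q] := A'0 i (L'0 _ p0 ir ir) (L'0 _ q0 ir (ltn_trans ir rq)).
  have [->//|jp] := eqVneq j p0; have [->//|jq] := eqVneq j q0.
  by rewrite A'E//; exact: L'0.
- move=> j rj; rewrite ltnS leq_eqVlt => /orP[/eqP jq|jq].
    by have -> : j = q0 by apply: val_inj.
  rewrite A'E; first exact: L'r.
    by rewrite -val_eqE/= gtn_eqF.
  by rewrite -val_eqE/= ltn_eqF.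
Qed.

End triangularization.

(** * Moments and nondegeneracy *)

Section moments.
Context d (T : measurableType d) (R : realType) (P : probability T R).

Lemma square_integrable_Lfun2 (Y : {RV P >-> R}) :
  (\int[P]_w (Y w ^+ 2)%:E < +oo)%E -> (Y : T -> R) \in Lfun P 2%:E.
Proof.
move=> Yfin; rewrite inE; apply/andP; split; rewrite inE//=.
rewrite /finite_norm unlock; apply: poweR_lty.
under eq_integral.
  move=> w _.
  have -> : (`|(Y w)%:E| `^ 2 = (Y w ^+ 2)%:E)%E.
    by rewrite /= powR_mulrn// real_normK// num_real.
  over.
exact: Yfin.
Qed.

Lemma ge0_integral_standard_normal (Y : {RV P >-> R}) (f : R -> \bar R) :
  has_normal_law Y 0 1 -> measurable_fun setT f -> (forall x, 0 <= f x)%E ->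
  (\int[P]_w f (Y w) = \int[@normal_prob R 0 1]_x f x)%E.
Proof.
move=> NY mf f0.
have mY : measurable_fun setT (fun w => Y w : measurableTypeR R).
  by move=> _ B mB; rewrite setTI; apply: (@measurable_preimage _ _ T R).
transitivity (\int[image_measure P mY]_x f x)%E.
  by rewrite /= ge0_integral_pushforward.
apply: eq_measure_integral => B mB _.
exact: standard_normalE.
Qed.

Lemma standard_normal_symmetric (B : set R) : measurable B ->
  @normal_prob R 0 1 [set x | B (- 1 * x)] = @normal_prob R 0 1 B.
Proof.
move=> mB; have n10 : - 1 != 0 :> R by rewrite oppr_eq0 oner_eq0.
rewrite (normal_prob_scale n10 mB).
rewrite /normal_prob; apply: eq_integral => x _; congr (_%:E).
by rewrite !normal_pdfE ?oner_neq0// /normal_peak /normal_fun sqrrN.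
Qed.

Lemma standard_normal_Lfun2 (Y : {RV P >-> R}) :
  has_normal_law Y 0 1 -> (Y : T -> R) \in Lfun P 2%:E.
Proof.
move=> NY; apply: square_integrable_Lfun2.
have msqr : measurable_fun setT (fun y : R => (y ^+ 2)%:E).
  by apply/measurable_EFinP; exact: measurable_funX.
rewrite (ge0_integral_standard_normal NY msqr).
  exact: normal_second_moment_lty.
by move=> y; rewrite lee_fin sqr_ge0.
Qed.

Lemma Lfun_2_1 (f : T -> R) : f \in Lfun P 2%:E -> f \in Lfun P 1.
Proof.
by move=> f2; exact: (Lfun_subset12 (fin_num_measure P _ measurableT)).
Qed.

(** Y and - Y have the same law, and the expectation is finite. *)
Lemma standard_normal_expectation (Y : {RV P >-> R}) :
  has_normal_law Y 0 1 -> ('E_P[Y] = 0)%E.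
Proof.
move=> NY.
pose Y' : {RV P >-> R} := (cst (- 1) \* Y)%R.
have Y1 := Lfun_2_1 (standard_normal_Lfun2 NY).
have EY' : ('E_P[Y'] = - 'E_P[Y])%E.
  have -> : (Y' : T -> R) = (- 1 \o* Y)%R.
    by apply/funext => w; rewrite /Y'/= mulrC.
  by rewrite expectationZl// EFinN mulN1e.
have Y'1 : (Y' : T -> R) \in Lfun P 1.
  have -> : (Y' : T -> R) = (- 1 \o* Y)%R.
    by apply/funext => w; rewrite /Y'/= mulrC.
  exact: Lfun_scale.
have EYY' : ('E_P[Y] = 'E_P[Y'])%E.
  have EV (V : {RV P >-> R}) : (V : T -> R) \in Lfun P 1 ->
      ('E_P[V] = \int[distribution P V]_y y%:E)%E.
    by move=> /Lfun1_integrable V1; rewrite unlock integral_distribution.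
  rewrite !EV//.
  apply: eq_measure_integral => B mB _.
  transitivity (@normal_prob R 0 1 B); first exact: (standard_normalE NY mB).
  rewrite -(standard_normal_symmetric mB); apply/esym.
  have m1 : measurable_fun setT (fun x : R => -1 * x).
    exact: measurable_funM.
  exact: (standard_normalE NY (measurable_preimage m1 mB)).
move: EYY'; rewrite EY'; have := expectation_fin_num Y1.
case: ('E_P[Y])%E => // r _ [] /eqP; rewrite -subr_eq0 opprK -mulr2n.
by rewrite mulrn_eq0/= => /eqP ->.
Qed.

Lemma Lfun1_linear_combination (I : finType) (a : I -> R) (f : I -> T -> R) :
  (forall i, f i \in Lfun P 1) ->
  (fun w => \sum_i a i * f i w) \in Lfun P 1 /\
  ('E_P[fun w => (\sum_i a i * f i w)%R] = \sum_i (a i)%:E * 'E_P[f i])%E.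
Proof.
move=> f1; rewrite /index_enum; elim: (Finite.enum I) => [|i r [r1 IH]].
  split; last first.
    rewrite big_nil; under eq_fun do rewrite big_nil.
    exact: expectation_cst.
  by under eq_fun do rewrite big_nil; exact: Lfun_cst.
have E : (fun w => \sum_(j <- i :: r) a j * f j w) =
    ((a i \o* f i) \+ (fun w => \sum_(j <- r) a j * f j w))%R.
  by apply/funext => w /=; rewrite big_cons mulrC.
have ai : (a i \o* f i)%R \in Lfun P 1 by exact: Lfun_scale.
rewrite E big_cons; split; first by rewrite rpredD.
by rewrite expectationD// expectationZl// IH.
Qed.

Lemma Lfun2_linear_combination (I : finType) (a : I -> R) (f : I -> T -> R) :
  (forall i, f i \in Lfun P 2%:E) ->
  (fun w => \sum_i a i * f i w) \in Lfun P 2%:E.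
Proof.
move=> f2.
have -> : (fun w => \sum_i a i * f i w) = \sum_i (a i \o* f i)%R.
  by apply/funext => w; rewrite fct_sumE; apply: eq_bigr => i _ /=; rewrite mulrC.
have le12 : (1 <= 2%:E :> \bar R)%E by rewrite lee_fin ler1n.
by apply: rpred_sum => i _; apply: Lfun_scale => //; rewrite ler1n.
Qed.

End moments.

Section gaussian_moments.
Context d (T : measurableType d) (R : realType) (P : probability T R).
Variables (m k : nat) (X : 'I_m -> {RV P >-> R}) (mu : 'I_m -> R).
Variables (A : 'M[R]_(m, k)) (Z : 'I_k -> {RV P >-> R}).
Hypothesis stdZ : standard_normal_vector Z.
Hypothesis XE : forall i w, X i w = mu i + \sum_(j < k) A i j * Z j w.

Lemma gaussian_expectation i : fine 'E_P[X i]%E = mu i.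
Proof.
have Z1 j : (Z j : T -> R) \in Lfun P 1.
  by apply: Lfun_2_1; apply: standard_normal_Lfun2; exact: stdZ.2.
have [S1 ES] := Lfun1_linear_combination (A i) Z1.
have -> : (X i : T -> R) = (cst (mu i) \+ (fun w => \sum_j A i j * Z j w))%R.
  by apply/funext => w; rewrite XE.
rewrite expectationD ?Lfun_cst// expectation_cst ES big1 ?adde0// => j _.
by rewrite standard_normal_expectation ?mule0//; exact: stdZ.2.
Qed.

Lemma centeredE i w : centered X i w = \sum_(j < k) A i j * Z j w.
Proof. by rewrite /centered/= gaussian_expectation XE addrAC subrr add0r. Qed.

(** If v A = 0, then the combination of the centered X_i with coefficients v is
    identically zero, so v is in the kernel of the covariance matrix. *)
Lemma positive_definite_row_free :
  positive_definite (covariance_matrix X) -> row_free A.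
Proof.
move=> [_ pd]; apply: inj_row_free => v vA; apply/eqP/negPn/negP => v0.
have := pd v v0; suff -> : v *m covariance_matrix X = 0.
  by rewrite mul0mx mxE ltxx.
apply/rowP => j; rewrite !mxE.
have l2 i : (centered X i : T -> R) \in Lfun P 2%:E.
  have -> : (centered X i : T -> R) = (fun w => \sum_j A i j * Z j w).
    by apply/funext => w; rewrite centeredE.
  apply: Lfun2_linear_combination => l.
  by apply: standard_normal_Lfun2; exact: stdZ.2.
have l1 i : (fun w => centered X i w * centered X j w) \in Lfun P 1.
  exact: Lfun2_mul_Lfun1 (l2 i) (l2 j).
have covE i : covariance P (X i) (X j) =
    'E_P[fun w => (centered X i w * centered X j w)%R]%E.
  by rewrite unlock.
have [_ ES] := Lfun1_linear_combination (v 0) l1.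
transitivity (fine 'E_P[fun w =>
  (\sum_i v 0 i * (centered X i w * centered X j w))%R]%E).
  rewrite ES -sum_fine; last first.
    by move=> i _; rewrite fin_numM// expectation_fin_num.
  apply: eq_bigr => i _; rewrite mxE covE fineM// expectation_fin_num//.
have -> : (fun w => \sum_i v 0 i * (centered X i w * centered X j w)) = cst 0.
  apply/funext => w /=.
  under eq_bigr do rewrite mulrA.
  rewrite -mulr_suml.
  have -> : \sum_i v 0 i * centered X i w = 0; last by rewrite mul0r.
  under eq_bigr do rewrite centeredE mulr_sumr.
  rewrite exchange_big/= big1// => l _.
  under eq_bigr do rewrite mulrA.
  rewrite -mulr_suml; have := congr1 (fun M : 'rV_k => M 0 l) vA.
  by rewrite !mxE => ->; rewrite mul0r.
by rewrite expectation_cst.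
Qed.

End gaussian_moments.

(** * Triangular systems and the sequential regression *)

Section lower_triangular.
Variables (F : fieldType) (m : nat) (L : 'M[F]_m).
Hypotheses (Ltrig : is_trig_mx L) (Lfree : row_free L).

Lemma trig_diag_neq0 i : L i i != 0.
Proof.
have : \det L != 0 by rewrite -unitfE -[_ \is a _]/(L \in unitmx) -row_free_unit.
rewrite det_trig// prodf_seq_neq0 => /allP/(_ i).
by rewrite mem_index_enum; apply.
Qed.

(** Back substitution: the last nonzero entry of u is removed with a multiple of
    the row of L that ends at the same place. *)
Lemma trig_row_span n (u : 'rV[F]_m) :
  (forall j : 'I_m, (n <= j)%N -> u 0 j = 0) ->
  exists v : 'rV[F]_m, (forall j : 'I_m, (n <= j)%N -> v 0 j = 0) /\ v *m L = u.
Proof.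
elim: n u => [|n IH] u u0.
  exists 0; split => [j _|]; first by rewrite mxE.
  by rewrite mul0mx; apply/rowP => j; rewrite mxE u0.
have [mn|nm] := leqP m n.
  have [|v [v0 vL]] := IH u.
    by move=> j nj; have := leq_trans mn nj; rewrite leqNgt ltn_ord.
  by exists v; split => // j nj; apply: v0; exact: ltnW.
pose i := Ordinal nm; pose a := u 0 i / L i i.
have [|v [v0 vL]] := IH (u - a *: row i L).
  move=> j; rewrite leq_eqVlt => /orP[/eqP nj|nj].
    have -> : j = i by apply: val_inj.
    by rewrite !mxE /a divfK ?subrr// trig_diag_neq0.
  by rewrite !mxE u0// (is_trig_mxP Ltrig i j nj) mulr0 subrr.
exists (v + a *: delta_mx 0 i); split => [j nj|].
  rewrite !mxE (v0 j (ltnW nj)) add0r; have -> : (j == i) = false.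
    by rewrite -val_eqE/= gtn_eqF.
  by rewrite andbF mulr0.
by rewrite mulmxDl vL -scalemxAl -rowE subrK.
Qed.

Lemma trig_row_regression (i : 'I_m) : exists v : 'rV[F]_m,
  (forall j : 'I_m, (i <= j)%N -> v 0 j = 0) /\
  forall j, L i j = \sum_l v 0 l * L l j + L i i *+ (i == j).
Proof.
have [|v [v0 vL]] := @trig_row_span i (row i L - L i i *: delta_mx 0 i).
  move=> j; rewrite leq_eqVlt => /orP[/eqP ij|ij].
    have -> : j = i by apply: val_inj.
    by rewrite !mxE !eqxx mulr1 subrr.
  rewrite !mxE (is_trig_mxP Ltrig i j ij) sub0r.
  have -> : (j == i) = false by rewrite -val_eqE/= gtn_eqF.
  by rewrite andbF mulr0 oppr0.
exists v; split => // j; have := congr1 (fun M : 'rV_m => M 0 j) vL.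
rewrite !mxE eqxx/= => ->; rewrite eq_sym mulr_natr subrK//.
Qed.

End lower_triangular.

Section sequential_regression_existence.
Context d (T : measurableType d) (R : realType) (P : probability T R).

Lemma normal_law_scale (Y : {RV P >-> R}) (a : R) : has_normal_law Y 0 1 ->
  a != 0 -> has_normal_law ((cst a \* Y)%R : {RV P >-> R}) 0 a.
Proof.
move=> NY a0 B mB; rewrite (negbTE a0) -normal_prob_scale//.
have ma : measurable_fun setT (fun x : R => a * x) by exact: measurable_funM.
exact: (standard_normalE NY (measurable_preimage ma mB)).
Qed.

(** After triangularization, X_i = sum_(j <= i) L_ij Z_j with L_ii != 0.  The row
    of L without its diagonal entry is a combination of the previous rows, so
    the part of X_i carried by the Z_j with j < i is the same combination of
    the previous X_j, and L_ii Z_i is left as the noise. *)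
Lemma gaussian_sequential_regression m (X : 'I_m -> {RV P >-> R}) :
  gaussian_vector X -> positive_definite (covariance_matrix X) ->
  exists (Lam : 'M[R]_m) (sigma : 'I_m -> R) (eps : 'I_m -> {RV P >-> R}),
    [/\ mutually_independent eps,
        forall i, sigma i != 0,
        forall i, has_normal_law (eps i) 0 (sigma i) &
        forall i w, centered X i w =
          \sum_(j < m | (j < i)%N) Lam i j * centered X j w + eps i w].
Proof.
move=> [k [mu [A [Z [iZ NZ XE]]]]] pd.
have [L [Z' [sZ' AL L0]]] := gaussian_triangularization A (conj iZ NZ).
have XE' i w : X i w = mu i + \sum_(j < k) L i j * Z' j w by rewrite XE AL.
have Lfree := positive_definite_row_free sZ' XE' pd.
have cE := centeredE sZ' XE'.
have mk : (m <= k)%N by rewrite -(eqP Lfree) rank_leq_col.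
move: mk L Z' sZ' L0 Lfree cE {XE' AL XE iZ NZ A Z} => /subnKC <-.
move: (k - m)%N => k' L Z sZ L0 Lfree cE.
(* Only the first m columns of L, hence the first m of the Z_j, contribute. *)
have rL : rsubmx L = 0.
  apply/matrixP => i j; rewrite !mxE L0//=.
  by rewrite (leq_trans (ltn_ord i))// leq_addr.
pose L1 := lsubmx L.
have L1trig : is_trig_mx L1.
  by apply/is_trig_mxP => i j ij; rewrite mxE L0.
have L1free : row_free L1.
  apply: inj_row_free => v vL1; apply: (row_free_inj Lfree).
  by rewrite mul0mx -[L]hsubmxK mul_mx_row rL mulmx0 -/L1 vL1 row_mx0.
pose Y i := Z (lshift k' i).
have cE1 i w : centered X i w = \sum_j L1 i j * Y j w.
  rewrite cE big_split_ord/= [X in _ + X]big1 ?addr0.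
    by apply: eq_bigr => j _; rewrite mxE.
  by move=> j _; have := congr1 (fun M : 'M[R]_(m, k') => M i j) rL;
    rewrite !mxE => ->; rewrite mul0r.
have [v vP] := choice (trig_row_regression L1trig L1free).
exists (\matrix_(i, j) v i 0 j), (fun i => L1 i i),
  (fun i => (cst (L1 i i) \* Y i)%R : {RV P >-> R}); split.
- apply: (@mutually_independent_comp _ _ _ _ _ Y _ (fun i x => L1 i i * x)) => //.
    by move=> i; exact: measurable_funM.
  exact (@mutually_independent_inj _ _ _ _ _ _ (@lshift m k') Z
    (@lshift_inj _ _) sZ.1).
- by move=> i; exact: trig_diag_neq0.
- by move=> i; apply: normal_law_scale; [exact: sZ.2|exact: trig_diag_neq0].
move=> i w; have [v0 vL] := vP i.
transitivity (\sum_l v i 0 l * centered X l w + L1 i i * Y i w); last first.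
  congr (_ + _); rewrite [RHS]big_mkcond/=; apply: eq_bigr => l _.
  by rewrite mxE; case: ltnP => // il; rewrite v0// mul0r.
under [X in _ = X + _]eq_bigr do rewrite cE1 mulr_sumr.
rewrite cE1; under [LHS]eq_bigr do rewrite vL mulrDl mulr_suml.
rewrite big_split/=; congr (_ + _); last first.
  rewrite (bigD1 i)//= eqxx big1 ?addr0// => j ji.
  by rewrite eq_sym (negbTE ji) mul0r.
rewrite exchange_big/=; apply: eq_bigr => l _.
by apply: eq_bigr => j _; rewrite mulrA.
Qed.

End sequential_regression_existence.

(** * Conditional law in a model with independent additive noise *)

Section location_kernel.
Context d (T : measurableType d) (R : realType) (P : probability T R).
Context d' (T' : measurableType d').
Variables (g : {mfun T' >-> R}) (E : {RV P >-> R}).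

Let measurable_shift x : measurable_fun setT (fun w => g x + E w).
Proof. exact: measurable_funD. Qed.

(** The law of g x + E; it is a version of the law of g W + E given W = x when
    W and E are independent. *)
Definition location_kernel (x : T') : {measure set R -> \bar R} :=
  image_measure P (@measurable_shift x).

Let measurable_location_set (B : set R) : measurable B ->
  measurable [set z : T' * T | B (g z.1 + E z.2)].
Proof.
move=> mB; apply: (@measurable_preimage _ _ _ R (fun z => g z.1 + E z.2)) => //.
apply: measurable_funD; first exact: measurableT_comp.
exact: measurableT_comp.
Qed.

Let measurable_location_kernel (B : set R) : measurable B ->
  measurable_fun setT (location_kernel ^~ B).
Proof.
move=> mB.
have -> : location_kernel ^~ B =
    (fun x => P (xsection [set z : T' * T | B (g z.1 + E z.2)] x)).
  apply/funext => x; congr (P _); apply/seteqP; split => w Bw.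
    by apply/xsectionP.
  by have /xsectionP := Bw.
exact: measurable_fun_xsection (measurable_location_set mB).
Qed.

HB.instance Definition _ :=
  @isKernel.Build _ _ _ _ R location_kernel measurable_location_kernel.

Let location_kernelT x : location_kernel x setT = 1%E.
Proof.
by rewrite /location_kernel/= /pushforward preimage_setT probability_setT.
Qed.

HB.instance Definition _ :=
  @Kernel_isProbability.Build _ _ _ _ R location_kernel location_kernelT.

(** By independence the joint law of (W, E) is a product measure, and integrating
    the sections of {(x, e) | A x, B (g x + e)} over x is the claim. *)
Lemma location_kernel_conditional (Y : T -> R) (W : {RV P >-> T'}) :
  (forall A B, measurable A -> measurable B ->
    P (W @^-1` A `&` E @^-1` B) = (P (W @^-1` A) * P (E @^-1` B))%E) ->
  (forall w, Y w = g (W w) + E w) ->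
  is_conditional_law P Y W location_kernel.
Proof.
move=> iWE YE A B mA mB.
pose S := [set z : T' * R | A z.1 /\ B (g z.1 + z.2)].
have mS : measurable S.
  have -> : S = fst @^-1` A `&` (fun z : T' * R => g z.1 + z.2) @^-1` B by [].
  apply: measurableI; apply: measurable_preimage => //.
  by apply: measurable_funD => //; exact: measurableT_comp.
have -> : W @^-1` A `&` Y @^-1` B = setT `&` [set w | S (W w, E w)].
  by rewrite setTI; apply/seteqP; split => w; rewrite /S/= YE.
rewrite independent_pair//; last first.
  by move=> A1 B1 mA1 mB1; rewrite probability_setT setTI mul1e iWE.
rewrite probability_setT mul1e /product_measure1/=.
transitivity (\int[distribution P W]_(x in A) location_kernel x B)%E.
  rewrite [RHS]integral_mkcond; apply: eq_integral => x _.
  rewrite patchE; case: ifPn => [/set_mem Ax|/negP Ax].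
    rewrite /distribution /location_kernel/= /pushforward; congr (P _).
    by apply/seteqP; split => w; [move=> /xsectionP[]|move=> Bw; apply/xsectionP].
  rewrite (_ : xsection S x = set0) ?measure0//.
  apply/seteqP; split => // y /xsectionP[/= Ax' _]; apply: Ax.
  exact: mem_set.
rewrite /distribution ge0_integral_pushforward//.
by apply: measurable_funTS; exact: measurable_location_kernel.
Qed.

End location_kernel.

(** * Signs of the regression coefficients *)

Section sequential_regression.
Context d (T : measurableType d) (R : realType) (P : probability T R).
Variables (m : nat) (X eps : 'I_m -> {RV P >-> R}).
Variables (c : 'I_m -> R) (Lam : 'M[R]_m).
Hypothesis ieps : mutually_independent eps.
Hypothesis XE : forall i w,
  X i w = c i + \sum_(j < m | (j < i)%N) Lam i j * X j w + eps i w.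

Let wid (i : 'I_m) (j : 'I_i) : 'I_m := widen_ord (ltnW (ltn_ord i)) j.

Definition regression_mean (i : 'I_m) (x : i.-tuple R) : R :=
  c i + \sum_(j < i) Lam i (wid j) * tnth x j.

Lemma measurable_regression_mean i : measurable_fun setT (@regression_mean i).
Proof.
apply: measurable_funD => //; apply: measurable_sum => j.
by apply: measurable_funM => //; exact: measurable_tnth.
Qed.

Lemma regression_meanE i w : X i w = regression_mean (past X i w) + eps i w.
Proof.
rewrite XE (big_ord_narrow (ltnW (ltn_ord i))); congr (_ + _ + _).
by apply: eq_bigr => j _; rewrite tnth_mktuple.
Qed.

Let noise_function (i : 'I_m) (n : nat) :
  forall j : 'I_m, (j < n)%N -> (j < i)%N ->
  exists f : i.-tuple R -> R, measurable_fun setT f /\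
    forall w, X j w = f (past eps i w).
Proof.
elim: n => // n IH j; rewrite ltnS => jn ji.
have /choice[f fP] : forall l : 'I_m, exists f : i.-tuple R -> R, (l < j)%N ->
    measurable_fun setT f /\ forall w, X l w = f (past eps i w).
  move=> l; have [lj|jl] := ltnP l j; last by exists (cst 0).
  have [f fP] := IH l (leq_trans lj jn) (ltn_trans lj ji).
  by exists f.
exists (fun x => c j + \sum_(l < m) (if (l < j)%N then Lam j l * f l x else 0)
  + tnth x (Ordinal ji)); split.
  apply: measurable_funD; last exact: measurable_tnth.
  apply: measurable_funD => //; apply: measurable_sum => l.
  case: ltnP => // lj; apply: measurable_funM => //.
  by have [] := fP l lj.
move=> w; rewrite XE big_mkcond tnth_mktuple; congr (_ + _ + eps _ w); last first.
  exact: val_inj.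
apply: eq_bigr => l _; case: ltnP => // lj.
by have [_ ->] := fP l lj.
Qed.

(** Unfolding the recursion, the past of X is a measurable function of the past of
    the noises, which is independent of the current noise. *)
Lemma regression_past_independent (i : 'I_m) (A : set (i.-tuple R)) (B : set R) :
  measurable A -> measurable B ->
  P (past X i @^-1` A `&` eps i @^-1` B) =
  (P (past X i @^-1` A) * P (eps i @^-1` B))%E.
Proof.
move=> mA mB.
have /choice[f fP] : forall j : 'I_i, exists f : i.-tuple R -> R,
    measurable_fun setT f /\ forall w, X (wid j) w = f (past eps i w).
  by move=> j; apply: (noise_function (ltn_ord (wid j))); exact: (ltn_ord j).
pose F x : i.-tuple R := [tuple f j x | j < i].
have mF : measurable_fun setT F.
  apply/measurable_fun_tnthP => j.
  rewrite (_ : _ \o _ = f j); first by have [] := fP j.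
  by apply/funext => w; rewrite /= tnth_mktuple.
have FE : past X i = F \o past eps i.
  apply/funext => w; apply: eq_from_tnth => j; rewrite !tnth_mktuple.
  by have [_ ->] := fP j.
rewrite FE comp_preimage past_independent//.
exact: measurable_preimage.
Qed.

Let regression_mfun (i : 'I_m) : {mfun i.-tuple R >-> R} :=
  HB.pack_for {mfun i.-tuple R >-> R} (@regression_mean i)
    (isMeasurableFun.Build _ _ _ _ _ (@measurable_regression_mean i)).

Let pastX (i : 'I_m) : {RV P >-> i.-tuple R} :=
  HB.pack_for {RV P >-> i.-tuple R} (past X i)
    (isMeasurableFun.Build _ _ _ _ _ (@measurable_past _ _ _ _ _ X i)).

(** The location kernel of the regression is monotone: increasing the past
    increases the regression mean pointwise. *)
Lemma nonnegative_regression_cis :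
  (forall i j : 'I_m, (j < i)%N -> 0 <= Lam i j) -> cis X.
Proof.
move=> Lam0 i.
exists (location_kernel (regression_mfun i) (eps i)); split.
  apply: (@location_kernel_conditional _ _ _ _ _ _ _ _ _ (pastX i)).
    by move=> A B mA mB; exact: regression_past_independent.
  exact: regression_meanE.
move=> t x y xy; rewrite /location_kernel/= /pushforward.
apply: le_measure; rewrite ?inE; [| |].
- by apply: measurable_preimage => //; exact: measurable_funD.
- by apply: measurable_preimage => //; exact: measurable_funD.
move=> w /=; rewrite !in_itv/= !andbT => /le_trans; apply.
rewrite lerD2r lerD2l; apply: ler_sum => j _.
by apply: ler_wpM2l => //; apply: Lam0 => /=.
Qed.


(** Let K = [t, +oo[.  For a past x' in A2, the value kappa x' K dominates all
    kappa x K with x in A1, hence P (A1, X_i in K) <= kappa x' K * P A1;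
    integrating over the pasts x' in A2 gives the claim.  Only averages occur,
    so the choice of the version kappa is immaterial. *)
Lemma cis_box_exchange (i : 'I_m) (kappa : R.-pker (i.-tuple R) ~> R) (t : R)
    (A1 A2 : set (i.-tuple R)) :
  is_conditional_law P (X i) (past X i) kappa ->
  (forall (t : R) (x y : i.-tuple R), (forall j, tnth x j <= tnth y j) ->
    (kappa x `[t, +oo[%classic <= kappa y `[t, +oo[%classic)%E) ->
  measurable A1 -> measurable A2 ->
  (forall x x', A1 x -> A2 x' -> forall j, tnth x j <= tnth x' j) ->
  (P (past X i @^-1` A1 `&` X i @^-1` `[t, +oo[) * P (past X i @^-1` A2) <=
   P (past X i @^-1` A2 `&` X i @^-1` `[t, +oo[) * P (past X i @^-1` A1))%E.
Proof.
move=> kappaE kappa_le mA1 mA2 le12.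
pose W := past X i.
have mW : measurable_fun setT W by exact: measurable_past.
have mWA1 : measurable (W @^-1` A1) by exact: measurable_preimage.
have mWA2 : measurable (W @^-1` A2) by exact: measurable_preimage.
pose K : set R := `[t, +oo[%classic.
have mK : measurable K by exact: measurable_itv.
have mkappa : measurable_fun setT (fun w => kappa (W w) K).
  exact: (measurableT_comp (measurable_kernel kappa K mK)).
have le_kappa x' : A2 x' ->
    (P (W @^-1` A1 `&` X i @^-1` K) <= kappa x' K * P (W @^-1` A1))%E.
  move=> A2x'; rewrite kappaE// -integral_cst//.
  apply: ge0_le_integral => //=.
  - exact: measurable_funTS.
  - by move=> w A1w; apply: kappa_le; exact: le12.
rewrite [X in (_ <= X * _)%E]kappaE// -integral_cst//.
rewrite -ge0_integralZr//; last exact: measurable_funTS.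
apply: ge0_le_integral => //=.
- by apply: emeasurable_funM => //; exact: measurable_funTS.
- by move=> w A2w; exact: le_kappa.
Qed.

Section necessity.
Variable sigma : 'I_m -> R.
Hypothesis sigma0 : forall i, sigma i != 0.
Hypothesis Neps : forall i, has_normal_law (eps i) 0 (sigma i).

Let eps_law i B : measurable B -> P (eps i @^-1` B) = normal_prob 0 (sigma i) B.
Proof. by move=> mB; have := Neps i mB; rewrite (negbTE (sigma0 i)). Qed.

Let box (x : 'I_m -> R) (r : R) (i : 'I_m) : set (i.-tuple R) :=
  tuple_box (fun j => `]x (wid j) - r, x (wid j) + r[%classic).

Let measurable_box x r i : measurable (@box x r i).
Proof. by apply: measurable_tuple_box => j. Qed.

Let past_boxE x r i : past X i @^-1` @box x r i =
  [set w | forall j : 'I_m, (j < i)%N -> `|X j w - x j| < r].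
Proof.
apply/seteqP; split => w H j.
  move=> ji; have := H (Ordinal ji); rewrite tnth_mktuple/= in_itv/=.
  rewrite (_ : wid _ = j); last exact: val_inj.
  by rewrite (_ : widen_ord _ _ = j) -?ltr_distl//; exact: val_inj.
by rewrite tnth_mktuple/= in_itv/= -ltr_distl; exact: (H (wid j) (ltn_ord j)).
Qed.

(* By induction on n: the new coordinate is within r of its target as soon as the
   noise is within r / 2 of the target residual e and the earlier coordinates
   are close enough, r', for the regression sum to move by at most r / 2. *)
Let box_event_gt0 n (x : 'I_m -> R) (r : R) : (n <= m)%N -> 0 < r ->
  (0 < P [set w | forall j : 'I_m, (j < n)%N -> (`|X j w - x j| < r)%R])%E.
Proof.
elim: n x r => [|n IH] x r nm r0.
  rewrite (_ : mkset _ = setT) ?probability_setT ?lte01//; apply/seteqP.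
  by split.
pose i := Ordinal nm.
pose S := 1 + \sum_(j < m | (j < i)%N) `|Lam i j|.
have S1 : 1 <= S by rewrite lerDl sumr_ge0.
have S0 : 0 < S by exact: lt_le_trans S1.
pose r' := r / 2 / S.
have r'0 : 0 < r' by rewrite !divr_gt0.
have r'S : r' * S = r / 2 by rewrite divfK// gt_eqF.
have r'r : r' <= r.
  by have := ler_wpM2l (ltW r'0) S1; rewrite mulr1 r'S; lra.
pose e := x i - c i - \sum_(j < m | (j < i)%N) Lam i j * x j.
pose E := eps i @^-1` `]e - r / 2, e + r / 2[.
have mE : measurable E by apply: measurable_preimage.
apply: (@lt_le_trans _ _ (P (past X i @^-1` @box x r' i `&` E))).
  rewrite regression_past_independent// mule_gt0//.
    by rewrite past_boxE IH// ltnW.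
  by rewrite eps_law// normal_prob_itv_gt0//; lra.
apply: le_measure; rewrite ?inE; [| |].
- apply: measurableI => //; apply: measurable_preimage.
    exact: measurable_past.
  exact: measurable_box.
- rewrite [Y in measurable Y](_ : _ =
    \bigcap_(j in [set j : 'I_m | (j < n.+1)%N])
      X j @^-1` `]x j - r, x j + r[); last first.
    apply/seteqP; split => w H j /= jn.
      by rewrite in_itv/= -ltr_distl; exact: H.
    by have := H j jn; rewrite /= in_itv/= -ltr_distl.
  apply: fin_bigcap_measurable => [|j _]; first exact: finite_finset.
  exact: measurable_preimage.
move=> w [Bw Ew] j; rewrite ltnS leq_eqVlt => /orP[/eqP jn|jn]; last first.
  apply: lt_le_trans r'r; move: Bw; rewrite past_boxE; exact.
have -> : j = i by apply: val_inj.
move: Bw; rewrite past_boxE => Bw.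
move: Ew; rewrite /E/= in_itv/= -ltr_distl => Ew.
have -> : X i w - x i = (eps i w - e) +
    \sum_(l < m | (l < i)%N) Lam i l * (X l w - x l).
  rewrite XE /e; under [X in _ = _ + X]eq_bigr do rewrite mulrBr.
  by rewrite sumrB; ring.
apply: le_lt_trans (ler_normD _ _) _.
have : `|\sum_(l < m | (l < i)%N) Lam i l * (X l w - x l)| <= r / 2.
  apply: le_trans (ler_norm_sum _ _ _) _.
  rewrite -r'S mulrDr mulr1 mulr_sumr.
  apply: (@le_trans _ _ (\sum_(l < m | (l < i)%N) r' * `|Lam i l|)).
    apply: ler_sum => l li; rewrite normrM mulrC ler_wpM2r//.
    by apply: ltW; exact: Bw.
  by rewrite lerDr ltW.
by move=> H; lra.
Qed.

Let past_box_gt0 x r i : 0 < r -> (0 < P (past X i @^-1` @box x r i))%E.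
Proof. by move=> r0; rewrite past_boxE box_event_gt0// ltnW. Qed.

Let regression_mean_box (x : 'I_m -> R) r (i : 'I_m) (y : i.-tuple R) :
  box x r y ->
  `|regression_mean y - (c i + \sum_(j < i) Lam i (wid j) * x (wid j))| <=
  r * \sum_(j < i) `|Lam i (wid j)|.
Proof.
move=> Bxy; rewrite /regression_mean opprD addrACA subrr add0r -sumrB.
apply: le_trans (ler_norm_sum _ _ _) _; rewrite mulr_sumr.
apply: ler_sum => j _; rewrite -mulrBr normrM mulrC ler_wpM2r//.
by have := Bxy j; rewrite /= in_itv/= -ltr_distl => /ltW.
Qed.

(** If Lambda_ij < 0, then shifting the j-th coordinate of the past up by one
    lowers the regression mean; the boxes are small enough for this to dominate
    their size, so that X_i >= 0 is strictly less likely on the upper box A2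
    than on the lower box A1, against [cis_box_exchange]. *)
Lemma cis_nonnegative_regression : cis X ->
  forall i j : 'I_m, (j < i)%N -> 0 <= Lam i j.
Proof.
move=> cisX i j0 j0i; rewrite leNgt; apply/negP => Lneg.
have [kappa [kappaE kappa_le]] := cisX i.
pose S := 1 + \sum_(j < i) `|Lam i (wid j)|.
have S1 : 1 <= S by rewrite lerDl sumr_ge0.
(* The mean is at least c_i - r S on A1 and at most c_i + Lam_ij + 3 r S on A2;
   the factor 8 leaves a gap of - Lam_ij - 4 r S = 4 r S between them. *)
pose r := - Lam i j0 / (8 * S).
have r0 : 0 < r by rewrite divr_gt0 ?mulr_gt0 ?oppr_gt0//; lra.
have rS : r * S = - Lam i j0 / 8 by rewrite /r; field; lra.
(* The shift by 2 r in every coordinate separates the boxes of radius r. *)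
pose y1 (j : 'I_m) : R := 0.
pose y2 (j : 'I_m) : R := 2 * r + (j == j0)%:R.
pose A1 := @box y1 r i; pose A2 := @box y2 r i.
pose W := past X i.
have mW : measurable_fun setT W by exact: measurable_past.
have mA1 : measurable A1 by exact: measurable_box.
have mA2 : measurable A2 by exact: measurable_box.
have pW1 : (0 < P (W @^-1` A1))%E by exact: past_box_gt0.
have pW2 : (0 < P (W @^-1` A2))%E by exact: past_box_gt0.
have mWA1 : measurable (W @^-1` A1) by exact: measurable_preimage.
have mWA2 : measurable (W @^-1` A2) by exact: measurable_preimage.
have le12 x x' : A1 x -> A2 x' -> forall j, tnth x j <= tnth x' j.
  move=> A1x A2x' j; have := A1x j; have := A2x' j.
  rewrite /= !in_itv/= /y1 /y2 => /andP[+ _] /andP[_ +].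
  by have := ler0n R (wid j == j0); lra.
have mean1 x : A1 x -> c i - r * S <= regression_mean x.
  move=> /regression_mean_box; rewrite ler_norml => /andP[+ _].
  have -> : \sum_(j < i) Lam i (wid j) * y1 (wid j) = 0.
    by apply: big1 => j _; rewrite /y1 mulr0.
  rewrite /S mulrDr mulr1; lra.
have mean2 x : A2 x -> regression_mean x <= c i + Lam i j0 + 3 * (r * S).
  move=> /regression_mean_box; rewrite ler_norml => /andP[_ +].
  have -> : \sum_(j < i) Lam i (wid j) * y2 (wid j) =
      2 * r * (\sum_(j < i) Lam i (wid j)) + Lam i j0.
    rewrite /y2; under eq_bigr do rewrite mulrDr.
    rewrite big_split/= -mulr_suml mulrC; congr (_ + _).
    have wj0 : wid (Ordinal j0i) = j0 by exact: val_inj.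
    rewrite (bigD1 (Ordinal j0i))// wj0 eqxx mulr1 big1; first exact: addr0.
    move=> j jj0.
    rewrite (_ : (wid j == j0) = false) ?mulr0//.
    by apply: contra_neqF jj0 => /eqP wj; apply: val_inj; exact: (congr1 val wj).
  have : \sum_(j < i) Lam i (wid j) <= \sum_(j < i) `|Lam i (wid j)|.
    by apply: ler_sum => j _; exact: ler_norm.
  move=> /(ler_wpM2l (ltW r0)); rewrite /S !mulrDr !mulr1; lra.
pose K : set R := `[0, +oo[%classic.
pose q a := normal_prob 0 (sigma i) `[a, +oo[.
pose a1 := c i - r * S; pose a2 := c i + Lam i j0 + 3 * (r * S).
have a21 : a2 < a1 by rewrite /a1 /a2; lra.
have mK : measurable K by exact: measurable_itv.
have mXK : measurable (X i @^-1` K) by exact: measurable_preimage.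
have low : (P (W @^-1` A1) * q (- a1)%R <= P (W @^-1` A1 `&` X i @^-1` K))%E.
  rewrite /q -eps_law// -regression_past_independent//.
  apply: le_measure; rewrite ?inE; [| |].
  - by apply: measurableI => //; exact: measurable_preimage.
  - exact: measurableI.
  move=> w [A1w /=]; rewrite in_itv/= andbT => ew; split => //=.
  rewrite /K/= in_itv/= andbT regression_meanE.
  by have := mean1 _ A1w; rewrite -/a1; lra.
have high : (P (W @^-1` A2 `&` X i @^-1` K) <= P (W @^-1` A2) * q (- a2)%R)%E.
  rewrite /q -eps_law// -regression_past_independent//.
  apply: le_measure; rewrite ?inE; [| |].
  - exact: measurableI.
  - by apply: measurableI => //; exact: measurable_preimage.
  move=> w [A2w]; rewrite /K/= in_itv/= andbT => Xw; split => //=.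
  rewrite in_itv/= andbT; move: Xw; rewrite regression_meanE.
  by have := mean2 _ A2w; rewrite -/a2; lra.
have exchange := cis_box_exchange 0 kappaE kappa_le mA1 mA2 le12.
have qlt : (q (- a2)%R < q (- a1)%R)%E.
  by apply: normal_prob_tail_lt => //; rewrite ltrN2.
have := le_trans (lee_wpmul2r (measure_ge0 P _) low) (le_trans exchange
  (lee_wpmul2r (measure_ge0 P (W @^-1` A1)) high)).
rewrite muleAC [X in (_ <= X)%E]muleAC [X in (_ <= X * _)%E]muleC.
rewrite lee_pmul2l ?fin_numM ?fin_num_measure ?mule_gt0//.
by rewrite leNgt qlt.
Qed.

End necessity.

End sequential_regression.

Theorem theorem2p1 (d : measure_display) (T : measurableType d) (R : realType)
    (P : probability T R) (m : nat) (X : 'I_m -> {RV P >-> R})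
    (gaussX : gaussian_vector X)
    (covX_pd : positive_definite (covariance_matrix X)) :
  cis X <-> positively_dag_dependent (full_dag m) (centered X).
Proof.
(* A regression of the centered vector is one of X itself with an intercept. *)
pose M i := fine ('E_P[X i])%E.
have regression (Lam : 'M[R]_m) (eps : 'I_m -> {RV P >-> R}) :
  (forall i w, centered X i w =
     \sum_(j < m | (j < i)%N) Lam i j * centered X j w + eps i w) ->
  forall i w, X i w = (M i - \sum_(j < m | (j < i)%N) Lam i j * M j) +
    \sum_(j < m | (j < i)%N) Lam i j * X j w + eps i w.
  move=> XcE i w; have := XcE i w; rewrite /centered/= -/(M i).
  under eq_bigr do rewrite -/(M _) mulrBr.
  by rewrite sumrB => /eqP; rewrite subr_eq => /eqP ->; ring.
split => [cisX|[Lam [sigma [eps [Lam0 ieps Neps XcE]]]]].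
  have [Lam [sigma [eps [ieps sigma0 Neps XcE]]]] :=
    gaussian_sequential_regression gaussX covX_pd.
  exists Lam, sigma, eps; split => //.
  exact: (cis_nonnegative_regression ieps (regression _ _ XcE) sigma0 Neps cisX).
exact: (nonnegative_regression_cis ieps (regression _ _ XcE) Lam0).
Qed.
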